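(* Let $0<p\leq1$ and $0<\alpha<\infty$, let $f\in C^1([-1,1])$ satisfy $f(0)=0$ and $L_\alpha(f)<\infty$, and let $\lambda\in\ell^{\alpha p}$ be a real sequence with $\|\lambda\|_\infty\leq1$. Then $$\|S_{\Psi_{f,\lambda}}:\mathcal B(\mathcal H)\longrightarrow\mathcal S^p\|\leq 2^{1/p}L_\alpha(f)\,\|\lambda\|_{\alpha p}^{\alpha}.$$
   Context: $\mathcal H$ is a separable infinite-dimensional complex Hilbert space with a fixed orthonormal basis $(e_j)_{j\ge1}$; $\mathcal B(\mathcal H)$ is the space of bounded operators with operator norm. For $0<p<\infty$, $\mathcal S^p$ is the Schatten class of compact $A$ with $\|A\|_p=(\sum_{j\ge1}s_j(A)^p)^{1/p}<\infty$, $s_j(A)$ being the singular values. For a sequence $x$ and $0<s<\infty$, $\|x\|_s=(\sum_j|x_j|^s)^{1/s}$ is the $\ell^s$ (quasi-)norm, and $\|x\|_\infty$ is the supremum norm. $L_\alpha(f):=\sup_{0<|t|\le1}|f'(t)|/|t|^\alpha$. The divided-difference matrix is $\Psi_{f,\lambda}(j,k)=\frac{f(\lambda_j)-f(\lambda_k)}{\lambda_j-\lambda_k}$ if $\lambda_j\neq\lambda_k$ and $\Psi_{f,\lambda}(j,k)=f'(\lambda_j)$ if $\lambda_j=\lambda_k$. For $A\in\mathcal B(\mathcal H)$ with entries $a_{jk}=\langle Ae_k,e_j\rangle$ (inner product linear in the first variable), $S_{\Psi_{f,\lambda}}(A)=(\Psi_{f,\lambda}(j,k)a_{jk})_{j,k\ge1}$.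 The norm is $\sup_{\|A\|\le1}\|S_{\Psi_{f,\lambda}}(A)\|_p$ over $A\in\mathcal B(\mathcal H)$. *)

(* Defs.v *)
From HB Require Import structures.
From mathcomp Require Import all_boot all_order all_algebra.
From mathcomp Require Import sesquilinear complex.
From mathcomp Require Import all_classical all_reals all_analysis.

Set Implicit Arguments.
Unset Strict Implicit.
Unset Printing Implicit Defensive.

Import Order.TTheory GRing.Theory Num.Theory.
Import numFieldNormedType.Exports.

Local Open Scope classical_set_scope.
Local Open Scope ring_scope.
Local Open Scope complex_scope.

(* In a normed space over R[i], `|x| is an element of R[i]; this is the same
   number seen in R. *)
Definition rnorm (R : realType) (V : normedModType R[i]) (x : V) : R :=
  complex.Re `|x|.

Definition seq_norm (R : realType) (s : \bar R) (x : R^nat) : \bar R :=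
  Lnorm counting s (EFin \o x).

Section Hilbert.
Variables (R : realType) (H : completeNormedModType R[i]).

(* The library's [{dot _ for _}] is linear in its first argument. *)
Definition norm_of_dot (dot : {dot H for (@Num.conj R[i])}) : Prop :=
  forall x : H, `|x| ^+ 2 = dot x x.

Variable dot : {dot H for (@Num.conj R[i])}.

Definition orthonormal_basis (e : nat -> H) : Prop :=
  (forall j k : nat, dot (e j) (e k) = (j == k)%:R) /\
  (forall x : H, series (fun j => dot x (e j) *: e j) @ \oo --> x).

Definition op_norm (A : {linear H -> H}) : \bar R :=
  ereal_sup [set (rnorm (A x))%:E | x in [set x : H | `|x| <= 1]].

Definition bounded_op (A : {linear H -> H}) : Prop := (op_norm A < +oo)%E.

Definition compact_op (A : {linear H -> H}) : Prop :=
  precompact (A @` [set x : H | `|x| <= 1]).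

Definition is_adjoint (A B : {linear H -> H}) : Prop :=
  forall x y : H, dot (A x) y = dot x (B y).

Definition has_dim (n : nat) (E : set H) : Prop :=
  exists v : 'I_n -> H,
    (forall c : 'I_n -> R[i], \sum_i c i *: v i = 0 -> forall i, c i = 0) /\
    E = [set x | exists c : 'I_n -> R[i], x = \sum_i c i *: v i].

(* The s_j are the square roots of the eigenvalues of A* A, in nonincreasing
   order and repeated according to multiplicity.  Only the positive
   eigenvalues are counted: when there are finitely many of them the
   remaining s_j are forced to be 0, and when there are infinitely many the
   kernel does not contribute.  For compact A this determines s. *)
Definition is_singular_values (A : {linear H -> H}) (s : R^nat) : Prop :=
  exists Astar : {linear H -> H},
    [/\ is_adjoint A Astar,
        forall j, 0 <= s j,
        forall j k : nat, (j <= k)%N -> s k <= s j &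
        forall mu : R, 0 < mu -> exists n : nat,
          ([set j | s j = mu] #= `I_n)%card /\
          has_dim n [set x : H | Astar (A x) = (mu ^+ 2)%:C *: x]].

Definition singular_values (A : {linear H -> H}) : R^nat :=
  xget (fun=> 0) [set s | is_singular_values A s].

(* Meaningful for compact A only. *)
Definition schatten_norm (p : R) (A : {linear H -> H}) : \bar R :=
  seq_norm p%:E (singular_values A).

Definition schatten_class (p : R) (A : {linear H -> H}) : Prop :=
  compact_op A /\ (schatten_norm p A < +oo)%E.

Variable e : nat -> H.

(* T is the bounded operator whose matrix in the basis e is the entrywise
   product of M with the matrix of A; there is at most one such T. *)
Definition is_schur_product (M : nat -> nat -> R[i]) (A T : {linear H -> H}) :
    Prop :=
  bounded_op T /\
  forall j k : nat, dot (T (e k)) (e j) = M j k * dot (A (e k)) (e j).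

Definition schur_maps_to_schatten (M : nat -> nat -> R[i]) (p : R) : Prop :=
  forall A : {linear H -> H}, bounded_op A ->
    exists2 T : {linear H -> H}, is_schur_product M A T & schatten_class p T.

Definition schur_norm (M : nat -> nat -> R[i]) (p : R) : \bar R :=
  ereal_sup [set schatten_norm p T | T in [set T : {linear H -> H} |
    exists A : {linear H -> H}, (op_norm A <= 1)%E /\ is_schur_product M A T]].

End Hilbert.

Section Symbol.
Variable R : realType.
Implicit Types (f : R -> R[i]) (alpha : R) (lambda : R^nat).

(* Complex-valued functions on [-1, 1], represented by total functions; the
   derivative is taken within [-1, 1], hence is one-sided at the endpoints,
   and values of f outside [-1, 1] are irrelevant. *)
Definition diff_quot f (x : R) : R -> R[i]^o :=
  fun y => (f y - f x) / (y - x)%:C.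

Definition deriv11 f (x : R) : R[i]^o :=
  lim (diff_quot f x @ within `[-1, 1] x^').

Definition C1_11 f : Prop :=
  (forall x : R, x \in `[-1, 1] ->
     cvg (diff_quot f x @ within `[-1, 1] x^')) /\
  {within `[-1, 1], continuous (deriv11 f)}.

Definition Lalpha alpha f : \bar R :=
  ereal_sup [set (rnorm (deriv11 f t) / (`|t| `^ alpha))%:E |
             t in [set t : R | 0 < `|t| <= 1]].

Definition divided_difference f lambda (j k : nat) : R[i] :=
  if lambda j == lambda k then deriv11 f (lambda j)
  else (f (lambda j) - f (lambda k)) / (lambda j - lambda k)%:C.

End Symbol.

(* Main.v *)
Require Import Defs.
From HB Require Import structures.
From mathcomp Require Import all_boot all_order all_algebra.
From mathcomp Require Import sesquilinear complex.
From mathcomp Require Import all_classical all_reals all_analysis.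
From mathcomp Require Import ess_sup_inf ring lra.

(** The divided differences satisfy
    [|Psi(j, k)| <= L * max(|lambda_j|, |lambda_k|) ^ alpha], by the mean value
    inequality ([divided_difference_le]); put [w_j = L * |lambda_j| ^ alpha].
    For a matrix [Psi] with entries bounded by [max(w_j, w_k)], assign each entry
    [(j, k)] to row [j] if [w_k <= w_j] and to column [k] otherwise.  The Schur
    product of [Psi] with a contraction [A] then becomes a sum of rank-one
    operators, one for each row and one for each column: in row [j] the multiplier
    is at most [w_j] and the rows of [A] have [l^2] norm at most 1, so the operator
    of row [j] has norm at most [w_j], and likewise for the columns
    ([schur_rank_one_terms]).

    If [T] is a sum of rank-one operators of norms at most [t_i], the sum of the
    [s_j(T)^p] is at most the sum of the [t_i^p] when [p <= 1]
    ([nuclear_singular_values_le]).  Here this gives twice the sum of the [w_j^p],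
    that is, the constant [2 ^ (1 / p)].  The inequality is obtained from its
    analogue for the concave functions [min(x, c)].  Let [m] be the number of
    [i] with [c <= t_i].  The first [m] singular values contribute at most [m * c]
    to the sum of the [min(s_j, c)]; the others have a sum bounded by that of the
    small [t_i] ([singular_tail_le]), because there are orthonormal vectors, all
    but [m] of the dimension available, on which the [m] large terms vanish, and on
    these the trace of [T] against a partial isometry sees only the small terms.
    Passing from truncations to powers is an Abel summation ([concave_domination]).

    For [p <= 1] the [w_j] are also summable, so the series of rank-one operators
    converges in norm.  Its sum is compact because the image of the unit ball lies in
    a continuous image of a product of segments ([nuclear_compact]), and it is the
    only bounded operator with the given matrix ([eq_bounded_op]). *)

Import Order.TTheory GRing.Theory Num.Theory.
Import numFieldNormedType.Exports.

Local Open Scope classical_set_scope.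
Local Open Scope ring_scope.

(** * Concave domination of sums *)

Section ConcaveDomination.
Context {R : realType}.
Implicit Types (phi : R -> R) (s t : nat -> R).

Definition supergradient phi (b kappa : R) : Prop :=
  forall x, 0 <= x -> phi x <= phi b + kappa * (x - b).

(** Concavity, in the form in which it is used: a supporting line at every
    positive point. *)
Definition superdifferentiable phi : Prop :=
  forall b, 0 < b -> exists kappa, supergradient phi b kappa.

(** Both ends of the chord lie below the supporting line at [x]. *)
Lemma chord_below phi a b x : superdifferentiable phi ->
  0 <= a -> a <= x -> x <= b -> a < b ->
  phi a + (phi b - phi a) / (b - a) * (x - a) <= phi x.
Proof.
move=> sphi a0 ax xb ab.
have ba : 0 < b - a by rewrite subr_gt0.
have [->|xa] := eqVneq x a; first by rewrite subrr mulr0 addr0.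
have x0 : 0 < x by apply: (le_lt_trans a0); rewrite lt_neqAle eq_sym xa.
have [k Hk] := sphi x x0.
have Ha := Hk a a0; have Hb := Hk b (ltW (le_lt_trans a0 ab)).
rewrite -subr_ge0.
have -> : phi x - (phi a + (phi b - phi a) / (b - a) * (x - a)) =
  ((b - x) * (phi x - phi a) - (x - a) * (phi b - phi x)) / (b - a).
  by field; lra.
apply: divr_ge0; last exact: ltW.
have h1 : (b - x) * (phi a) <= (b - x) * (phi x + k * (a - x)).
  by apply: ler_wpM2l => //; lra.
have h2 : (x - a) * (phi b) <= (x - a) * (phi x + k * (b - x)).
  by apply: ler_wpM2l => //; lra.
by lra.
Qed.

Definition truncated_sum (N : nat) s (c : R) : R :=
  \sum_(j < N) Order.min (s j) c.

Definition increment_above phi (a x : R) : R := phi (Order.max x a) - phi a.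

Lemma increment_above_split phi (a b x : R) : a < b ->
  increment_above phi a x =
  increment_above phi b x + (phi (Order.min (Order.max x a) b) - phi a).
Proof.
move=> ab; rewrite /increment_above.
have [bx|xb] := leP b x.
  rewrite max_l ?min_r//; last by rewrite (le_trans (ltW ab)).
  by lra.
by rewrite subrr add0r min_l// ge_max (ltW xb) ltW.
Qed.

Lemma clamp_increment (a b x : R) : a < b ->
  Order.min (Order.max x a) b - a = Order.min x b - Order.min x a.
Proof.
move=> ab.
have [xa|ax] := leP x a.
  by rewrite (min_l (ltW ab)) (min_l (le_trans xa (ltW ab))) !subrr.
by have [xb|bx] := leP x b.
Qed.

(** Since no [s j] lies strictly between the knots [a] and [b], the function
    agrees on [a, b] with its chord at the clamped [s j], while it lies above the
    chord at the clamped [t i]. *)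
Lemma domination_step {phi} {N M} {s t} {eps a b kappa : R} :
  superdifferentiable phi -> 0 <= a -> a < b ->
  (forall j, (j < N)%N -> (s j <= a) || (b <= s j)) ->
  0 <= truncated_sum M t b + eps - truncated_sum N s b ->
  supergradient phi b kappa ->
  \sum_(j < N) increment_above phi b (s j) <= \sum_(i < M) increment_above phi b (t i)
    + kappa * (truncated_sum M t b + eps - truncated_sum N s b) ->
  \sum_(j < N) increment_above phi a (s j) <= \sum_(i < M) increment_above phi a (t i)
    + (phi b - phi a) / (b - a)
      * (truncated_sum M t a + eps - truncated_sum N s a).
Proof.
move=> sphi a0 ab gap Db kb IH.
set k := (phi b - phi a) / (b - a).
have ba : 0 < b - a by rewrite subr_gt0.
have kk : kappa <= k.
  rewrite /k ler_pdivlMr//; have := kb a a0; lra.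
have Hs : \sum_(j < N) increment_above phi a (s j) =
    \sum_(j < N) increment_above phi b (s j)
    + k * (truncated_sum N s b - truncated_sum N s a).
  rewrite /truncated_sum -sumrB mulr_sumr -big_split/=; apply: eq_bigr => j _.
  rewrite (increment_above_split phi _ _ _ ab); congr (_ + _).
  case/orP: (gap j (ltn_ord j)) => sj.
    rewrite (max_r sj) (min_l (ltW ab)) (min_l sj) (min_l (le_trans sj (ltW ab))).
    by rewrite !subrr mulr0.
  have sa : a <= s j by rewrite (le_trans (ltW ab)).
  rewrite (max_l sa) (min_r sj) (min_r sa) /k divfK//; lra.
have Ht : \sum_(j < M) increment_above phi b (t j)
    + k * (truncated_sum M t b - truncated_sum M t a) <=
    \sum_(j < M) increment_above phi a (t j).
  rewrite /truncated_sum -sumrB mulr_sumr -big_split/=; apply: ler_sum => j _.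
  rewrite (increment_above_split phi _ _ _ ab) lerD2l -clamp_increment//.
  rewrite lerBrDr addrC.
  apply: chord_below => //.
    by rewrite le_min le_max lexx orbT ltW.
  by rewrite ge_min lexx orbT.
have Hkk := ler_wpM2r Db kk.
by lra.
Qed.

(** Abel summation from the top down, by induction on the number of [s j] above
    [a].  The coefficient [kappa] bounds the slopes of [phi] beyond [a]; these
    slopes decrease, so the gaps between the truncated sums only ever enter with
    nonnegative coefficients. *)
Lemma increment_domination {phi} {N M} {s t} {eps : R} :
  superdifferentiable phi ->
  (forall x y : R, 0 <= x -> x <= y -> phi x <= phi y) ->
  (forall c : R, 0 < c -> truncated_sum N s c <= truncated_sum M t c + eps) ->
  forall n a kappa, (\sum_(j < N) (a < s j)%R <= n)%N -> 0 < a ->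
  supergradient phi a kappa ->
  \sum_(j < N) increment_above phi a (s j) <= \sum_(i < M) increment_above phi a (t i)
    + kappa * (truncated_sum M t a + eps - truncated_sum N s a).
Proof.
move=> sphi mphi dom; elim=> [|n IH] a kappa.
  rewrite leqn0 sum_nat_eq0 => /forallP none a0 ka.
  rewrite big1 => [|j _]; last first.
    have := none j; rewrite /= eqb0 -leNgt => sa.
    by rewrite /increment_above max_r ?subrr.
  apply: addr_ge0.
    apply: sumr_ge0 => i _; rewrite subr_ge0; apply: mphi; first exact: ltW.
    by rewrite le_max lexx orbT.
  apply: mulr_ge0; last by rewrite subr_ge0 dom.
  have a1 : 0 <= a + 1 by lra.
  by have := ka _ a1; have := mphi a (a + 1) (ltW a0); lra.
move=> cnt a0 ka.
have [/existsP[j0 sj0]|] := boolP [exists j : 'I_N, a < s j]; last first.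
  move=> /existsPn none; apply: IH => //.
  by rewrite big1// => j _; rewrite (negbTE (none j)).
have [j aj minj] := @Order.TotalTheory.arg_minP _ _ _ j0 (fun j : 'I_N => a < s j) s sj0.
have b0 : 0 < s j by exact: lt_trans aj.
have [kb Hkb] := sphi _ b0.
have Da : 0 <= truncated_sum M t a + eps - truncated_sum N s a.
  by rewrite subr_ge0 dom.
have Db : 0 <= truncated_sum M t (s j) + eps - truncated_sum N s (s j).
  by rewrite subr_ge0 dom.
have step := domination_step sphi (ltW a0) aj _ Db Hkb.
apply: le_trans.
  apply: step => //.
  - move=> i iN; case: (leP (s i) a) => //= ai.
    exact: (minj (Ordinal iN)).
  apply: IH => //.
  rewrite -ltnS (leq_trans _ cnt)//.
  rewrite [X in (_ < X)%N](bigD1 j)//= aj (bigD1 j)//= ltxx add0n add1n ltnS.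
  apply: leq_sum => i _.
  have [ji|//] := ltP (s j) (s i); by rewrite (lt_trans aj ji).
rewrite lerD2l; apply: ler_wpM2r => //.
by rewrite ler_pdivrMr ?subr_gt0//; have := ka _ (ltW b0); lra.
Qed.

(** A concave function vanishing at 0 is a mixture of the truncations
    [min(x, c)], so an inequality between sums of truncations at every level
    passes to [phi].  Integrating against a mixing measure is replaced by chords
    with knots at [b] and the [s j], and this is where the constant [phi b / b], the slope
    of the first chord, comes from. *)
Lemma concave_domination {phi} {N M} {s t} {eps b : R} :
  superdifferentiable phi ->
  (forall x y : R, 0 <= x -> x <= y -> phi x <= phi y) -> phi 0 = 0 ->
  0 < b -> (forall j, (j < N)%N -> b <= s j) -> (forall i, 0 <= t i) ->
  (forall c : R, 0 < c -> truncated_sum N s c <= truncated_sum M t c + eps) ->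
  \sum_(j < N) phi (s j) <= \sum_(i < M) phi (t i) + phi b / b * eps.
Proof.
move=> sphi mphi phi0 b0 bs t0 dom.
have [kb Hkb] := sphi _ b0.
have Db : 0 <= truncated_sum M t b + eps - truncated_sum N s b.
  by rewrite subr_ge0 dom.
have gap j : (j < N)%N -> (s j <= 0) || (b <= s j) by move=> /bs ->; rewrite orbT.
have := domination_step sphi (lexx 0) b0 gap Db Hkb
  (increment_domination sphi mphi dom _ _ _ (leqnn _) b0 Hkb).
rewrite phi0 !subr0.
under eq_bigr => j _ do
  rewrite /increment_above phi0 subr0 max_l ?(le_trans (ltW b0) (bs _ (ltn_ord j)))//.
under [X in _ <= X + _ -> _]eq_bigr => j _ do
  rewrite /increment_above phi0 subr0 max_l//.
have z0 L (u : nat -> R) : (forall j, (j < L)%N -> 0 <= u j) ->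
    truncated_sum L u 0 = 0.
  by move=> u0; apply: big1 => j _; rewrite min_r ?u0.
rewrite (z0 M)// (z0 N) => [|j jN]; last exact: le_trans (ltW b0) (bs _ jN).
by rewrite add0r subr0.
Qed.

(** At [b = 1] this is Young's inequality for the pair [u ^ p], [1]; the general
    case follows by homogeneity. *)
Lemma powR_superdifferentiable (p : R) : 0 < p <= 1 ->
  superdifferentiable (fun x => x `^ p).
Proof.
move=> /andP[p0 p1] b b0; exists (p * (b `^ p / b)) => x x0.
have key : forall u : R, 0 <= u -> u `^ p <= 1 + p * (u - 1).
  move=> u u0; have [->|pn1] := eqVneq p 1; first by rewrite powRr1//; lra.
  have q0 : 0 < 1 - p by rewrite subr_gt0 lt_neqAle pn1.
  have := @conjugate_powR R (u `^ p) 1 p^-1 (1 - p)^-1 (powR_ge0 _ _) ler01.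
  rewrite !invrK mulr1 powR1 mul1r -powRrM divff ?gt_eqF// powRr1//.
  rewrite !invr_gt0 => /(_ p0 q0) H.
  by have := H _; lra.
have bn0 : b != 0 by rewrite gt_eqF.
have := key (x / b) (divr_ge0 x0 (ltW b0)).
rewrite -(ler_pM2l (powR_gt0 p b0)) -powRM ?(ltW b0)//; last exact: divr_ge0 (ltW _).
rewrite mulrC divfK// => /le_trans; apply.
by rewrite le_eqVlt; apply/orP; left; apply/eqP; field.
Qed.

End ConcaveDomination.

(** * Real-valued norms and inner products *)

Notation cabs c := (@rnorm _ (_[i]^o)%type c).
Notation "x %:C" := (real_complex _ x) : ring_scope.

Section RealNorm.
Context {R : realType} {V : normedModType R[i]}.
Implicit Types (x y : V).

Lemma rnormE x : `|x| = (rnorm x)%:C.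
Proof. by rewrite RRe_real// ger0_real. Qed.

Lemma rnorm_ge0 x : 0 <= rnorm x.
Proof. by rewrite -ler0c -rnormE. Qed.

Lemma rnorm0 : rnorm (0 : V) = 0.
Proof. by rewrite /rnorm normr0. Qed.

Lemma rnorm0_eq0 x : rnorm x = 0 -> x = 0.
Proof. by move=> x0; apply/eqP; rewrite -normr_eq0 rnormE x0. Qed.

Lemma rnormN x : rnorm (- x) = rnorm x.
Proof. by rewrite /rnorm normrN. Qed.

Lemma ler_rnormD x y : rnorm (x + y) <= rnorm x + rnorm y.
Proof. by rewrite -lecR rmorphD/= -!rnormE ler_normD. Qed.

Lemma ler_rnormB x y : rnorm (x - y) <= rnorm x + rnorm y.
Proof. by rewrite (le_trans (ler_rnormD _ _))// rnormN. Qed.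

Lemma ler_rnorm_sum I (r : seq I) (P : pred I) (F : I -> V) :
  rnorm (\sum_(i <- r | P i) F i) <= \sum_(i <- r | P i) rnorm (F i).
Proof.
elim/big_ind2 : _ => [|a b c d ab cd|//]; first by rewrite rnorm0.
by rewrite (le_trans (ler_rnormD _ _))// lerD.
Qed.

End RealNorm.

Section Modulus.
Context {R : realType}.
Implicit Types (c d : R[i]).

Lemma cabsE c : cabs c = ComplexField.Normc.normc c.
Proof. by rewrite /rnorm; case: c. Qed.

Lemma rnormZ {V : normedModType R[i]} c (x : V) : rnorm (c *: x) = cabs c * rnorm x.
Proof.
by apply: complexI; rewrite -rnormE normrZ rmorphM/= -!rnormE.
Qed.

Lemma cabsM c d : cabs (c * d) = cabs c * cabs d.
Proof. by rewrite !cabsE ComplexField.Normc.normcM. Qed.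

Lemma cabs_real (r : R) : cabs r%:C = `|r|.
Proof. by rewrite cabsE /= expr0n addr0 sqrtr_sqr. Qed.

Lemma cabs_conj c : cabs (Num.conj c) = cabs c.
Proof. by rewrite /rnorm norm_conjC. Qed.

Lemma conj_realC (r : R) : Num.conj r%:C = r%:C.
Proof. exact: conjc_real. Qed.

Lemma mul_conj_cabs c : c * Num.conj c = (cabs c ^+ 2)%:C.
Proof. by rewrite -normCK rmorphXn/= -rnormE. Qed.

Lemma ler_Re_cabs c : complex.Re c <= cabs c.
Proof.
by rewrite -lecR -rnormE (le_trans _ (normc_ge_Re c))// lecR ler_norm.
Qed.

End Modulus.

(** Cauchy-Schwarz for finite real sums. *)
Lemma sum_mul_le {R : realType} (I : finType) (a b : I -> R) (A B : R) :
  (forall i, 0 <= a i) -> (forall i, 0 <= b i) -> 0 <= A -> 0 <= B ->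
  \sum_i a i ^+ 2 <= A ^+ 2 -> \sum_i b i ^+ 2 <= B ^+ 2 ->
  \sum_i a i * b i <= A * B.
Proof.
move=> a0 b0 A0 B0 aA bB.
have zero (u : I -> R) : (forall i, 0 <= u i) -> \sum_i u i ^+ 2 <= 0 ^+ 2 ->
    forall i, u i = 0.
  move=> u0; rewrite expr0n/= => uu i; apply/eqP; rewrite -sqrf_eq0 eq_le sqr_ge0 andbT.
  apply: le_trans uu; rewrite (bigD1 i)//= lerDl.
  by apply: sumr_ge0 => j _; exact: sqr_ge0.
have [Az|An] := eqVneq A 0.
  rewrite Az in aA *; rewrite mul0r big1// => i _.
  by rewrite (zero _ a0 aA) mul0r.
have [Bz|Bn] := eqVneq B 0.
  rewrite Bz in bB *; rewrite mulr0 big1// => i _.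
  by rewrite (zero _ b0 bB) mulr0.
have Ap : 0 < A by rewrite lt_neqAle eq_sym An.
have Bp : 0 < B by rewrite lt_neqAle eq_sym Bn.
have amgm i : a i * b i <= (B / A / 2) * a i ^+ 2 + (A / B / 2) * b i ^+ 2.
  rewrite -subr_ge0.
  have -> : B / A / 2 * a i ^+ 2 + A / B / 2 * b i ^+ 2 - a i * b i
    = (B * a i - A * b i) ^+ 2 / (2 * A * B) by field; rewrite An Bn.
  by rewrite divr_ge0 ?sqr_ge0// !mulr_ge0.
apply: le_trans (ler_sum _ (fun i _ => amgm i)) _.
rewrite big_split/= -!mulr_sumr.
have -> : A * B = B / A / 2 * A ^+ 2 + A / B / 2 * B ^+ 2 by field; rewrite An Bn.
by apply: lerD; apply: ler_wpM2l => //; rewrite !divr_ge0.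
Qed.

Section InnerProduct.
Context {R : realType} {H : completeNormedModType R[i]}.
Variable dot : {dot H for (@Num.conj R[i])}.
Implicit Types (x y z : H) (c : R[i]).

Lemma dotC x y : dot x y = Num.conj (dot y x).
Proof. by rewrite hermC expr0 mul1r. Qed.

Lemma dotZl c x y : dot (c *: x) y = c * dot x y.
Proof. by rewrite linearZl_LR. Qed.

Lemma dotZr c x y : dot x (c *: y) = Num.conj c * dot x y.
Proof. by rewrite linearZr_LR. Qed.

Lemma dot_suml I (r : seq I) (P : pred I) (F : I -> H) y :
  dot (\sum_(i <- r | P i) F i) y = \sum_(i <- r | P i) dot (F i) y.
Proof. exact: linear_sumlz. Qed.

Lemma dot_sumr I (r : seq I) (P : pred I) (F : I -> H) y :
  dot y (\sum_(i <- r | P i) F i) = \sum_(i <- r | P i) dot y (F i).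
Proof. exact: linear_sumr. Qed.

Definition orthonormal_family {I : finType} (w : I -> H) : Prop :=
  forall i j, dot (w i) (w j) = (i == j)%:R.

Lemma dot_combination {I : finType} (w : I -> H) (c d : I -> R[i]) :
  orthonormal_family w ->
  dot (\sum_i c i *: w i) (\sum_i d i *: w i) = \sum_i c i * Num.conj (d i).
Proof.
move=> ow; rewrite dot_suml; apply: eq_bigr => i _.
rewrite dot_sumr (bigD1 i)//= big1 => [|j ji].
  by rewrite dotZl dotZr ow eqxx mulr1 addr0.
by rewrite dotZl dotZr ow eq_sym (negbTE ji) !mulr0.
Qed.

Hypothesis Hdot : norm_of_dot dot.

Lemma dotxx x : dot x x = (rnorm x ^+ 2)%:C.
Proof. by rewrite -Hdot rnormE rmorphXn. Qed.

Lemma rnorm_combination {I : finType} (w : I -> H) (c : I -> R[i]) :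
  orthonormal_family w ->
  rnorm (\sum_i c i *: w i) ^+ 2 = \sum_i cabs (c i) ^+ 2.
Proof.
move=> ow; apply: complexI; rewrite -dotxx dot_combination// rmorph_sum/=.
by apply: eq_bigr => i _; rewrite mul_conj_cabs.
Qed.

(** The squared norm of [x] minus its projection is nonnegative. *)
Lemma bessel {I : finType} {w : I -> H} x : orthonormal_family w ->
  \sum_i cabs (dot x (w i)) ^+ 2 <= rnorm x ^+ 2.
Proof.
move=> ow; set y := \sum_i dot x (w i) *: w i.
have xy : dot x y = (\sum_i cabs (dot x (w i)) ^+ 2)%:C.
  rewrite dot_sumr rmorph_sum/=; apply: eq_bigr => i _.
  by rewrite dotZr mulrC mul_conj_cabs.
have yy : dot y y = (\sum_i cabs (dot x (w i)) ^+ 2)%:C.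
  by rewrite dotxx rnorm_combination.
have : 0 <= dot (x - y) (x - y) by exact: dnorm_ge0.
rewrite linearBl !linearBr/= [dot y x]dotC xy yy dotxx.
rewrite conj_realC subrr subr0 -rmorphB/= ler0c.
by rewrite subr_ge0.
Qed.

Lemma rnorm1 x : dot x x = 1 -> rnorm x = 1.
Proof.
rewrite dotxx => /(@complexI _ _ 1) xx.
by apply/eqP; rewrite -(@eqrXn2 _ 2)// ?rnorm_ge0// xx expr1n.
Qed.

Lemma unit_vector x : x != 0 ->
  dot (((rnorm x)^-1)%:C *: x) (((rnorm x)^-1)%:C *: x) = 1.
Proof.
move=> x0; have n0 : rnorm x != 0.
  by apply: contra x0 => /eqP /rnorm0_eq0 ->.
rewrite dotZl dotZr dotxx conj_realC -!rmorphM/=.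
by have -> : (rnorm x)^-1 * ((rnorm x)^-1 * rnorm x ^+ 2) = 1 by field.
Qed.

Lemma cauchy_schwarz x y : cabs (dot x y) <= rnorm x * rnorm y.
Proof.
have [->|y0] := eqVneq y 0; first by rewrite linear0r !rnorm0 mulr0.
have n0 : rnorm y != 0 by apply: contra y0 => /eqP /rnorm0_eq0 ->.
have on : orthonormal_family (fun _ : 'I_1 => ((rnorm y)^-1)%:C *: y).
  by move=> i j; rewrite unit_vector// !ord1 eqxx.
have := bessel x on; rewrite big_ord1 ler_sqr ?nnegrE ?rnorm_ge0//.
rewrite dotZr cabsM cabs_conj cabs_real ger0_norm ?invr_ge0 ?rnorm_ge0//.
by rewrite ler_pdivrMl ?lt_neqAle ?(eq_sym 0) ?n0 ?rnorm_ge0// mulrC.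
Qed.

End InnerProduct.

(** * Singular vectors and tails of singular values *)

Section FiniteDimension.
Context {R : realType} {H : completeNormedModType R[i]}.
Variable dot : {dot H for (@Num.conj R[i])}.
Hypothesis Hdot : norm_of_dot dot.

Definition independent {n} (v : 'I_n -> H) : Prop :=
  forall c : 'I_n -> R[i], \sum_i c i *: v i = 0 -> forall i, c i = 0.

Lemma orthonormal_independent {n} {w : 'I_n -> H} :
  orthonormal_family dot w -> independent w.
Proof.
move=> ow c cw i; have : dot (\sum_i c i *: w i) (w i) = 0 by rewrite cw linear0l.
rewrite dot_suml (bigD1 i)//= big1 => [|j ji].
  by rewrite dotZl ow eqxx mulr1 addr0.
by rewrite dotZl ow (negbTE ji) mulr0.
Qed.

(** A homogeneous system with fewer equations than unknowns has a nonzero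
    solution. *)
Lemma unit_vector_avoiding {n k} (v : 'I_n -> H) (g : 'I_k -> H) :
  independent v -> (k < n)%N ->
  exists c : 'I_n -> R[i],
    let x := \sum_a c a *: v a in dot x x = 1 /\ forall b, dot x (g b) = 0.
Proof.
move=> iv kn; pose K := \matrix_(a < n, b < k) dot (v a) (g b).
have : kermx K != 0.
  rewrite -mxrank_eq0 mxrank_ker -lt0n subn_gt0.
  exact: leq_ltn_trans (rank_leq_col _) kn.
move=> /rowV0Pn[u /sub_kermxP uK u0].
pose x := \sum_a u 0 a *: v a.
have x0 : x != 0.
  apply: contra u0 => /eqP /iv u0; apply/eqP/rowP => a; by rewrite u0 mxE.
exists (fun a => ((rnorm x)^-1)%:C * u 0 a).
have -> : \sum_a (((rnorm x)^-1)%:C * u 0 a) *: v a = ((rnorm x)^-1)%:C *: x.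
  by rewrite scaler_sumr; apply: eq_bigr => a _; rewrite scalerA.
split; first exact: unit_vector.
move=> b; rewrite dotZl dot_suml.
have := congr1 (fun M : 'rV_k => M 0 b) uK; rewrite !mxE => uKb.
rewrite (_ : \sum_a _ = 0) ?mulr0// -[RHS]uKb.
by apply: eq_bigr => a _; rewrite dotZl mxE.
Qed.

(** Vectors are added one at a time, each new one being orthogonal to the previous
    ones and to the [g b].  With no [g b] this gives an orthonormal basis of an
    eigenspace; with the [g b] of finitely many rank-one terms it gives an
    orthonormal family killed by these terms. *)
Lemma orthonormal_avoiding {n k} (v : 'I_n -> H) (g : 'I_k -> H) l :
  independent v -> (l + k <= n)%N ->
  exists w : 'I_l -> H,
    [/\ orthonormal_family dot w,
        forall i, exists c : 'I_n -> R[i], w i = \sum_a c a *: v a &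
        forall i b, dot (w i) (g b) = 0].
Proof.
move=> iv; elim: l => [_|l IH lkn].
  by exists (fun=> 0); split; case.
have [w [ow sw gw]] := IH (ltnW lkn).
pose g' (b : 'I_(l + k)) := match fintype.split b with inl i => w i | inr j => g j end.
have [c /= [xx xg]] := unit_vector_avoiding v g' iv lkn.
set x := \sum_a _ in xx xg.
have xw i : dot x (w i) = 0.
  by rewrite -(xg (lshift k i)) /g' -[lshift _ _]/(unsplit (inl i)) unsplitK.
have xgb b : dot x (g b) = 0.
  by rewrite -(xg (rshift l b)) /g' -[rshift _ _]/(unsplit (inr b)) unsplitK.
exists (fun i => if unlift ord0 i is Some j then w j else x); split.
- move=> i j.
  case: (unliftP ord0 i) => [i' ->|->]; case: (unliftP ord0 j) => [j' ->|->] //=.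
  by rewrite dotC xw rmorph0.
- move=> i; case: (unlift ord0 i) => [i'|]; [exact: sw|by exists c].
- by move=> i b; case: (unlift ord0 i).
Qed.

End FiniteDimension.

Section SingularVectors.
Context {R : realType} {H : completeNormedModType R[i]}.
Variable dot : {dot H for (@Num.conj R[i])}.
Hypothesis Hdot : norm_of_dot dot.

(** Eigenvectors of [Ts T]: an orthonormal basis is chosen in each eigenspace and
    numbered by the indices of that singular value; for different singular values
    orthogonality follows from [dot (T x) (T y) = dot x (Ts (T y))]. *)
Lemma singular_vectors {T : {linear H -> H}} {s : R^nat} :
  is_singular_values dot T s ->
  exists x : nat -> H,
    (forall j k, 0 < s j -> 0 < s k -> dot (x j) (x k) = (j == k)%:R) /\
    (forall j k, 0 < s j -> 0 < s k ->
       dot (T (x j)) (T (x k)) = (s k ^+ 2)%:C * (j == k)%:R).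
Proof.
move=> [Ts [adj s0 _ Hs]].
have /choice[X HX] : forall mu : R, exists X : nat -> H, 0 < mu ->
    (forall j k, s j = mu -> s k = mu -> dot (X j) (X k) = (j == k)%:R) /\
    (forall j, s j = mu -> Ts (T (X j)) = (mu ^+ 2)%:C *: X j).
  move=> mu; have [mu0|] := ltP 0 mu; last by exists (fun=> 0).
  have [n [/card_set_bijP[f fbij] [v [iv Ev]]]] := Hs mu mu0.
  have finj j k : s j = mu -> s k = mu -> f j = f k -> j = k.
    by move=> sj sk; apply: (set_bij_inj fbij); rewrite inE.
  have fn j : s j = mu -> (f j < n)%N by move=> sj; exact: (set_bij_homo fbij).
  have n0 : (n + 0 <= n)%N by rewrite addn0.
  have [w [ow sw _]] := orthonormal_avoiding dot Hdot v (fun _ : 'I_0 => 0) n iv n0.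
  exists (fun j => if insub (f j) is Some i then w i else 0) => _; split.
    move=> j k sj sk; rewrite !insubT ?fn// => jn kn /=; rewrite ow -val_eqE /=.
    suff -> : (f j == f k) = (j == k) by [].
    by apply/eqP/eqP => [/finj|->//]; exact.
  move=> j sj; rewrite insubT ?fn// => jn /=.
  have : [set x | Ts (T x) = (mu ^+ 2)%:C *: x] (w (Sub (f j) jn)).
    by rewrite Ev; exact: sw.
  by [].
pose x j := X (s j) j.
have eig j : 0 < s j -> Ts (T (x j)) = (s j ^+ 2)%:C *: x j.
  by move=> sj; have [_] := HX _ sj; exact.
have TT j k : 0 < s k -> dot (T (x j)) (T (x k)) = (s k ^+ 2)%:C * dot (x j) (x k).
  by move=> sk; rewrite adj eig// dotZr conj_realC.
have ox j k : 0 < s j -> 0 < s k -> dot (x j) (x k) = (j == k)%:R.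
  move=> sj sk; have [sjk|sjk] := eqVneq (s j) (s k).
    by have [H1 _] := HX _ sj; rewrite /x -sjk H1.
  have jk : j != k by apply: contra sjk => /eqP ->.
  rewrite (negbTE jk).
  have : (s k ^+ 2)%:C * dot (x j) (x k) = (s j ^+ 2)%:C * dot (x j) (x k).
    rewrite -TT// dotC TT// rmorphM/=.
    by rewrite conj_realC -dotC.
  move=> /eqP; rewrite -subr_eq0 -mulrBl mulf_eq0 -rmorphB/= => /orP[|/eqP//].
  move=> /eqP /(@complexI _ _ 0) /eqP; rewrite subr_eq0 eqrXn2 ?s0// => /eqP ks.
  by rewrite ks eqxx in sjk.
by exists x; split => // j k sj sk; rewrite TT// ox.
Qed.

End SingularVectors.

Section TailBound.
Context {R : realType}.

(** Moving mass from an index before [m] to one from [m] on cannot increase the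
    weighted sum: with [d] the indicator of the last indices, [s j - s m] and
    [P j - d j] have the same sign. *)
Lemma weighted_sum_ge_tail {N m : nat} {s P : nat -> R} :
  (forall j k, (j <= k)%N -> s k <= s j) ->
  (forall j, (j < N)%N -> 0 <= P j <= 1) ->
  (m <= N)%N -> \sum_(j < N) P j = (N - m)%:R ->
  \sum_(j < N | (m <= j)%N) s j <= \sum_(j < N) s j * P j.
Proof.
move=> smono P01 mN sP.
pose d (j : nat) : R := (m <= j)%N%:R.
have sd : \sum_(j < N) d j = (N - m)%:R.
  rewrite /d -natr_sum; congr (_%:R).
  rewrite -(big_mkord xpredT (fun j => (m <= j)%N : nat)) (big_cat_nat _ mN)//=.
  rewrite big_nat big1 => [|j /andP[_ jm]]; last by rewrite leqNgt jm.
  rewrite add0n big_nat (eq_bigr (fun=> 1%N)) => [|j /andP[-> _]//].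
  by rewrite -big_nat sum_nat_const_nat muln1.
have : 0 <= \sum_(j < N) (s j - s m) * (P j - d j).
  apply: sumr_ge0 => j _; have /andP[P0 P1] := P01 j (ltn_ord j).
  rewrite /d; have [mj|jm] := leqP m j.
    by rewrite mulr_le0// subr_le0// smono.
  by rewrite mulr_ge0// subr_ge0// smono// ltnW.
have -> : \sum_(j < N) (s j - s m) * (P j - d j) =
    \sum_(j < N) s j * P j - \sum_(j < N) s j * d j
    - s m * (\sum_(j < N) P j - \sum_(j < N) d j).
  by rewrite -!sumrB mulr_sumr -sumrB; apply: eq_bigr => j _; ring.
rewrite sP sd subrr mulr0 subr0 subr_ge0; apply: le_trans.
rewrite big_mkcond/=; apply: ler_sum => j _.
by rewrite /d; case: leqP => _; rewrite ?mulr1 ?mulr0.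
Qed.

Context {H : completeNormedModType R[i]}.
Variable dot : {dot H for (@Num.conj R[i])}.
Hypothesis Hdot : norm_of_dot dot.

Lemma orthonormal_rnorm {I : finType} {w : I -> H} i :
  orthonormal_family dot w -> rnorm (w i) = 1.
Proof. by move=> ow; apply: (rnorm1 _ Hdot); rewrite ow eqxx. Qed.

(** The mechanism is a trace inequality.  Write [u] for the isometry taking each
    singular vector [x j] to [T (x j) / s j], and take an orthonormal family [z a]
    in the span of the [x j], with [N - #|I|] members, on which the terms indexed
    by [I] vanish.  The sum over [a] of [dot (T (z a)) (u (z a))] is a weighted sum
    of the [s j] with weights in [0, 1] of total mass [N - #|I|], hence at least
    the tail; and each remaining rank-one term contributes at most [t i] to it, by
    Cauchy-Schwarz and the Bessel inequality for the families [z] and [u]. *)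
Lemma singular_tail_le {T : {linear H -> H}} {N M : nat} {s : nat -> R}
    {x g h : nat -> H} {t : nat -> R} {eps : R} (I : {set 'I_M}) :
  (forall j k, (j <= k)%N -> s k <= s j) ->
  (forall j, (j < N)%N -> 0 < s j) ->
  (forall j k, (j < N)%N -> (k < N)%N -> dot (x j) (x k) = (j == k)%:R) ->
  (forall j k, (j < N)%N -> (k < N)%N ->
     dot (T (x j)) (T (x k)) = (s k ^+ 2)%:C * (j == k)%:R) ->
  (forall i, rnorm (g i) * rnorm (h i) <= t i) -> 0 <= eps ->
  (forall z, rnorm (T z - \sum_(i < M) dot z (g i) *: h i) <= eps * rnorm z) ->
  \sum_(j < N | (#|I| <= j)%N) s j <= \sum_(i < M | i \notin I) t i + N%:R * eps.
Proof.
move=> smono sp ox oT ght eps0 Teps.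
have t0 i : 0 <= t i by apply: le_trans (ght i); rewrite mulr_ge0 ?rnorm_ge0.
have [mN|Nm] := leqP #|I| N; last first.
  rewrite big1 => [|j]; last first.
    by rewrite leqNgt (ltn_trans (ltn_ord j) Nm).
  by rewrite addr_ge0 ?sumr_ge0// mulr_ge0.
set l := (N - #|I|)%N.
have lIN : (l + #|I| <= N)%N by rewrite subnK.
pose X (j : 'I_N) := x j.
have oX : orthonormal_family dot X by move=> j k; rewrite ox.
have [z [oz sz gz]] := orthonormal_avoiding dot Hdot X (fun b : 'I_#|I| => g (enum_val b))
  l (orthonormal_independent dot oX) lIN.
pose y (j : 'I_N) := ((s j)^-1)%:C *: T (x j).
have s_n0 (j : 'I_N) : s j != 0 by rewrite gt_eqF ?sp.
have oy : orthonormal_family dot y.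
  move=> j k; rewrite dotZl dotZr oT// conj_realC -[_ == _ :> nat]/(j == k).
  have [->|_] := eqVneq j k; last by rewrite !mulr0.
  rewrite mulr1 -!rmorphM/=.
  have := s_n0 k => sk0.
  by have -> : (s k)^-1 * ((s k)^-1 * s k ^+ 2) = 1 by field.
have Ty (j : 'I_N) : T (x j) = (s j)%:C *: y j.
  by rewrite /y scalerA -rmorphM/= divff// scale1r.
have /choice[c zE] : forall a : 'I_l, exists c : 'I_N -> R[i],
  z a = \sum_j c j *: X j by [].
pose u a := \sum_j c a j *: y j.
have ou : orthonormal_family dot u.
  by move=> a b; rewrite dot_combination// -oz !zE dot_combination.
have cE a j : c a j = dot (z a) (X j).
  rewrite zE dot_suml (bigD1 j)//= big1 => [|k kj].
    by rewrite dotZl oX eqxx mulr1 addr0.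
  by rewrite dotZl oX (negbTE kj) mulr0.
(* The weights: squared lengths of the projections of the [X j] on the span of the
   [z a]. *)
pose P (j : nat) : R := if insub j is Some j' then \sum_a cabs (c a j') ^+ 2 else 0.
have PE (j : 'I_N) : P j = \sum_a cabs (c a j) ^+ 2 by rewrite /P valK.
have P01 j : (j < N)%N -> 0 <= P j <= 1.
  move=> jN; rewrite (PE (Ordinal jN)); apply/andP; split.
    by apply: sumr_ge0 => a _; exact: sqr_ge0.
  have := bessel _ Hdot (X (Ordinal jN)) oz.
  rewrite (orthonormal_rnorm _ oX) expr1n; apply: le_trans.
  by apply: ler_sum => a _; rewrite cE dotC cabs_conj.
have sumP : \sum_(j < N) P j = (N - #|I|)%:R.
  under eq_bigr do rewrite PE.
  rewrite exchange_big/= (eq_bigr (fun=> 1)) => [|a _].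
    by rewrite sumr_const card_ord.
  by rewrite -(rnorm_combination dot Hdot X _ oX) -zE (orthonormal_rnorm _ oz) expr1n.
apply: le_trans (weighted_sum_ge_tail smono P01 mN sumP) _.
pose B w := \sum_(i < M) dot w (g i) *: h i.
have diag : \sum_(j < N) s j * P j = \sum_a complex.Re (dot (T (z a)) (u a)).
  have -> : \sum_a complex.Re (dot (T (z a)) (u a)) =
      \sum_a \sum_(j < N) s j * cabs (c a j) ^+ 2.
    apply: eq_bigr => a _.
    have -> : T (z a) = \sum_j (c a j * (s j)%:C) *: y j.
      rewrite zE [LHS]linear_sum/=.
      by apply: eq_bigr => j _; rewrite linearZ/= Ty scalerA.
    rewrite dot_combination//.
    have -> : \sum_(j < N) c a j * (s j)%:C * Num.conj (c a j) =
        (\sum_(j < N) s j * cabs (c a j) ^+ 2)%:C.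
      rewrite rmorph_sum/=; apply: eq_bigr => j _.
      by rewrite mulrAC mul_conj_cabs -rmorphM/= mulrC.
    by [].
  rewrite exchange_big/=; apply: eq_bigr => j _; by rewrite PE mulr_sumr.
rewrite diag.
(* The crude bound [eps] for each [a] suffices: the number of vectors stays fixed
   while the remainder of the series tends to 0. *)
have split_le a : complex.Re (dot (T (z a)) (u a)) <=
    \sum_(i < M | i \notin I) cabs (dot (z a) (g i)) * cabs (dot (u a) (h i)) + eps.
  have -> : T (z a) = B (z a) + (T (z a) - B (z a)) by rewrite addrC subrK.
  rewrite linearDl/= raddfD/=; apply: lerD.
    apply: le_trans (ler_Re_cabs _) _; rewrite /B dot_suml.
    apply: le_trans (ler_rnorm_sum _ _ _ _) _.
    rewrite (bigID (mem I))/= big1 => [|i iI].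
      rewrite add0r; apply: ler_sum => i _.
      by rewrite dotZl cabsM [dot (h i) _]dotC cabs_conj.
    rewrite dotZl.
    have := gz a (enum_rank_in iI i); rewrite enum_rankK_in// => ->.
    by rewrite mul0r rnorm0.
  apply: le_trans (ler_Re_cabs _) _.
  apply: le_trans (cauchy_schwarz _ Hdot _ _) _.
  rewrite (orthonormal_rnorm _ ou) mulr1; apply: le_trans (Teps _) _.
  by rewrite (orthonormal_rnorm _ oz) mulr1.
apply: le_trans (ler_sum _ (fun a _ => split_le a)) _.
rewrite big_split/= sumr_const card_ord -[eps *+ l]mulr_natl.
apply: lerD; last by apply: ler_wpM2r => //; rewrite ler_nat leq_subr.
rewrite exchange_big/=; apply: ler_sum => i _; apply: le_trans (ght i).
apply: sum_mul_le; rewrite ?rnorm_ge0//; try by move=> a; exact: rnorm_ge0.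
  under eq_bigr do rewrite dotC cabs_conj.
  exact: bessel.
under eq_bigr do rewrite dotC cabs_conj.
exact: bessel.
Qed.

End TailBound.

(** * Singular values of nuclear operators *)

Lemma sum_const_lt {R : realDomainType} {N m : nat} {c : R} : 0 <= c ->
  \sum_(j < N | (j < m)%N) c <= m%:R * c.
Proof.
move=> c0; rewrite big_mkcond/=.
suff -> : \sum_(j < N) (if (j < m)%N then c else 0) = (minn N m)%:R * c.
  by rewrite ler_wpM2r// ler_nat geq_minr.
elim: N => [|N IH]; first by rewrite big_ord0 min0n mul0r.
rewrite big_ord_recr/= IH; have [Nm|mN] := ltnP N m.
  by rewrite (minn_idPl Nm) -natr1 mulrDl mul1r.
by rewrite addr0 (minn_idPr (leqW mN)).
Qed.

Section NuclearOperators.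
Context {R : realType} {H : completeNormedModType R[i]}.
Variable dot : {dot H for (@Num.conj R[i])}.
Hypothesis Hdot : norm_of_dot dot.

(** Truncating at level [c]: the rank-one terms with [c <= t i] form an
    operator of rank at most their number, so that after dropping as many
    singular values the remaining terms control the others. *)
Lemma singular_truncated_sum_le {T : {linear H -> H}} {N M : nat} {s : nat -> R}
    {x g h : nat -> H} {t : nat -> R} {eps c : R} :
  (forall j k, (j <= k)%N -> s k <= s j) ->
  (forall j, (j < N)%N -> 0 < s j) ->
  (forall j k, (j < N)%N -> (k < N)%N -> dot (x j) (x k) = (j == k)%:R) ->
  (forall j k, (j < N)%N -> (k < N)%N ->
     dot (T (x j)) (T (x k)) = (s k ^+ 2)%:C * (j == k)%:R) ->
  (forall i, rnorm (g i) * rnorm (h i) <= t i) -> 0 <= eps ->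
  (forall z, rnorm (T z - \sum_(i < M) dot z (g i) *: h i) <= eps * rnorm z) ->
  0 < c -> truncated_sum N s c <= truncated_sum M t c + N%:R * eps.
Proof.
move=> smono sp ox oT ght eps0 Teps c0.
pose I : {set 'I_M} := [set i : 'I_M | c <= t i]%SET.
have tail := singular_tail_le _ Hdot I smono sp ox oT ght eps0 Teps.
have split_t : truncated_sum M t c = #|I|%:R * c + \sum_(i < M | i \notin I) t i.
  rewrite /truncated_sum (bigID (mem I))/=; congr (_ + _).
    rewrite -sumr_const mulr_suml; apply: eq_bigr => i.
    by rewrite inE mul1r => /min_r.
  by apply: eq_bigr => i; rewrite inE -ltNge => /ltW /min_l.
have split_s : truncated_sum N s c <=
    #|I|%:R * c + \sum_(j < N | (#|I| <= j)%N) s j.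
  rewrite /truncated_sum (bigID (fun j : 'I_N => (j < #|I|)%N))/=; apply: lerD.
    apply: (@le_trans _ _ (\sum_(j < N | (j < #|I|)%N) c)).
      by apply: ler_sum => j _; rewrite ge_min lexx orbT.
    exact: sum_const_lt (ltW c0).
  under [X in _ <= X]eq_bigl do rewrite leqNgt.
  by apply: ler_sum => j _; rewrite ge_min lexx.
by rewrite split_t -addrA; apply: le_trans split_s _; rewrite lerD2l.
Qed.

(** For fixed [N] the truncated sums of the singular values are dominated by
    those of the first [M] terms [t i] up to [N.+1 * eps M], so concave domination
    applies to the power function; the error disappears as [M] grows.  For
    [p = 1] this is the triangle inequality for the trace norm; for [p < 1] it
    replaces the inequality of Rotfel'd for the [p]-th power of the Schatten
    quasi-norm. *)
Lemma nuclear_singular_values_le {T : {linear H -> H}} {s : R^nat}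
    {g h : nat -> H} {t eps : nat -> R} {p K : R} :
  0 < p <= 1 -> is_singular_values dot T s ->
  (forall i, rnorm (g i) * rnorm (h i) <= t i) -> (forall M, 0 <= eps M) ->
  (forall M z, rnorm (T z - \sum_(i < M) dot z (g i) *: h i) <= eps M * rnorm z) ->
  (forall d, 0 < d -> exists M, eps M <= d) ->
  (forall M, \sum_(i < M) t i `^ p <= K) ->
  forall N, \sum_(j < N) s j `^ p <= K.
Proof.
move=> /[dup] p01 /andP[p0 p1] Hs ght eps0 Teps epscvg tK.
have t0 i : 0 <= t i by apply: le_trans (ght i); rewrite mulr_ge0 ?rnorm_ge0.
have [x [ox oT]] := singular_vectors _ Hdot Hs.
have [_ [_ s0 smono _]] := Hs.
elim=> [|N IH]; first by rewrite big_ord0; have := tK 0; rewrite big_ord0.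
have := s0 N; rewrite le_eqVlt => /orP[/eqP sN|sN].
  by rewrite big_ord_recr/= -sN powR0 ?addr0// gt_eqF.
have bs j : (j < N.+1)%N -> s N <= s j by move=> jN; apply: smono.
have sp j : (j < N.+1)%N -> 0 < s j by move=> /bs; exact: lt_le_trans.
pose C := s N `^ p / s N * N.+1%:R.
have C0 : 0 <= C by rewrite mulr_ge0// divr_ge0 ?powR_ge0.
have bound M : \sum_(j < N.+1) s j `^ p <= K + C * eps M.
  have := @concave_domination _ _ N.+1 M s t (N.+1%:R * eps M) (s N)
    (powR_superdifferentiable p p01) _ _ sN bs t0 _.
  move=> /(_ _ _ _)/le_trans; apply.
  - by move=> a b a0 ab; apply: ge0_ler_powR; rewrite ?nnegrE ?(ltW p0)// (le_trans a0).
  - by rewrite powR0// gt_eqF.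
  - move=> c c0; apply: (singular_truncated_sum_le (x := x) smono sp _ _ ght (eps0 M) (Teps M) c0).
      by move=> j k /sp sj /sp sk; rewrite ox.
    by move=> j k /sp sj /sp sk; rewrite oT.
  by rewrite mulrA; apply: lerD.
apply/ler_addgt0Pr => d d0.
have [M HM] := epscvg (d / (C + 1)) (divr_gt0 d0 (ltr_wpDl C0 ltr01)).
apply: le_trans (bound M) _; rewrite lerD2l.
apply: le_trans (ler_wpM2l C0 HM) _.
by rewrite mulrA ler_pdivrMr ?ltr_wpDl// mulrC ler_wpM2l ?(ltW d0)// lerDl.
Qed.

End NuclearOperators.

Section SequenceNorms.
Context {R : realType}.

Lemma seq_norm_le {u : R^nat} {q K : R} : 0 < q ->
  (forall N, \sum_(j < N) `|u j| `^ q <= K) ->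
  (seq_norm q%:E u <= (K `^ q^-1)%:E)%E.
Proof.
move=> q0 uK; rewrite /seq_norm Lnorm_counting//.
have K0 : 0 <= K by have := uK 0; rewrite big_ord0.
rewrite -poweR_EFin; apply: gt0_ler_poweR.
- by rewrite invr_ge0 ltW.
- rewrite in_itv/= leey andbT; apply: nneseries_ge0 => n _ _.
  by rewrite lee_fin powR_ge0.
- by rewrite in_itv/= leey andbT lee_fin.
apply: lime_le; first by apply: is_cvg_nneseries => *; rewrite lee_fin powR_ge0.
apply: nearW => N; rewrite big_mkord.
rewrite (eq_bigr (fun j : 'I_N => (`|u j| `^ q)%:E)) => [|j _]; last by [].
by rewrite sumEFin lee_fin; exact: uK.
Qed.

Lemma seq_norm_lt_pinfty {u : R^nat} {q : R} : 0 < q ->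
  (seq_norm q%:E u < +oo)%E ->
  exists S : R, [/\ 0 <= S, seq_norm q%:E u = (S `^ q^-1)%:E &
    forall N, \sum_(j < N) `|u j| `^ q <= S].
Proof.
move=> q0; rewrite /seq_norm Lnorm_counting// => fin.
set X := limn _ in fin *.
have X0 : (0 <= X)%E by apply: nneseries_ge0 => *; rewrite lee_fin powR_ge0.
have Xy : (X < +oo)%E by apply: lty_poweRy fin; rewrite invr_neq0// gt_eqF.
have XE : X = (fine X)%:E by rewrite fineK// ge0_fin_numE.
exists (fine X); split; first exact: fine_ge0.
  by rewrite -poweR_EFin -XE.
move=> N; rewrite -lee_fin -XE -sumEFin.
have := @nneseries_lim_ge R (fun k => (`|(EFin \o u) k| `^ q)%E) xpredT 0 N.
by rewrite big_mkord; apply => *; rewrite lee_fin powR_ge0.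
Qed.

End SequenceNorms.

(** * Completeness and orthogonal series *)

Section RealNormConvergence.
Context {R : realType} {H : completeNormedModType R[i]}.
Implicit Types (u : nat -> H) (x y l : H).

Lemma rnorm_cvgP {V : normedModType R[i]} {T : Type} {F : set_system T}
    {FF : Filter F} (f : T -> V) (l : V) :
  (f @ F --> l) <->
  (forall d : R, 0 < d -> \forall t \near F, rnorm (l - f t) <= d).
Proof.
split=> [/cvgrPdist_le fl d d0|fl].
  have d0' : (0 : R[i]) < d%:C by rewrite ltcR.
  by near=> t; rewrite -lecR -rnormE; near: t; exact: fl.
apply/cvgrPdist_le => eps eps0.
have /ger0_real/RRe_real epsE := ltW eps0.
have : 0 < complex.Re eps by rewrite -ltcR epsE.
move=> /fl; apply: filterS => t.
by rewrite -lecR -rnormE epsE.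
Unshelve. all: by end_near. Qed.

Lemma rnorm_le_small x {K : R} : (forall d, 0 < d -> rnorm x <= K + d) -> rnorm x <= K.
Proof. by move=> xK; apply/ler_addgt0Pr. Qed.

(** The modulus [delta] survives in the limit; all later estimates compare a
    limit with a partial sum. *)
Lemma cauchy_modulus u (delta : nat -> R) :
  (forall d, 0 < d -> exists M, delta M <= d) ->
  (forall m n, (m <= n)%N -> rnorm (u n - u m) <= delta m) ->
  exists l, forall m, rnorm (l - u m) <= delta m.
Proof.
move=> delta0 udelta.
have /cauchy_cvg uc : cauchy (u @ \oo).
  apply: cauchy_exP => eps eps0.
  have /ger0_real/RRe_real epsE := ltW eps0.
  have Re0 : 0 < complex.Re eps by rewrite -ltcR epsE.
  have [M HM] := delta0 (complex.Re eps / 2) (divr_gt0 Re0 (ltr0Sn _ _)).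
  exists (u M); exists M => // n /= Mn.
  rewrite -ball_normE /= distrC rnormE -epsE ltcR.
  apply: le_lt_trans (udelta _ _ Mn) _; apply: le_lt_trans HM _; lra.
exists (lim (u @ \oo)) => m; apply: rnorm_le_small => d d0.
have [N _ HN] := (rnorm_cvgP u _).1 uc d d0.
have -> : lim (u @ \oo) - u m = (lim (u @ \oo) - u (maxn m N)) + (u (maxn m N) - u m).
  by rewrite addrA subrK.
apply: le_trans (ler_rnormD _ _) _; rewrite addrC; apply: lerD.
  by apply: udelta; exact: leq_maxl.
by apply: HN => /=; exact: leq_maxr.
Qed.

Lemma small_multiple {c d : R} {eps : nat -> R} : 0 <= c -> 0 < d ->
  (forall d, 0 < d -> exists M, eps M <= d) -> exists M, c * eps M <= d.
Proof.
move=> c0 d0 eps_small.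
have c1 : 0 < c + 1 by lra.
have [M HM] := eps_small (d / (c + 1)) (divr_gt0 d0 c1).
exists M; apply: le_trans (ler_wpM2l c0 HM) _.
by rewrite mulrA ler_pdivrMr// mulrC ler_wpM2l ?(ltW d0)// lerDl.
Qed.

Lemma rnorm_eq0_small x (C : R) (eps : nat -> R) :
  (forall d, 0 < d -> exists M, eps M <= d) -> 0 <= C ->
  (forall M, rnorm x <= C * eps M) -> x = 0.
Proof.
move=> eps_small C0 xC; apply: rnorm0_eq0; apply: le_anti.
rewrite rnorm_ge0 andbT; apply: rnorm_le_small => d d0; rewrite add0r.
by have [M HM] := small_multiple C0 d0 eps_small; exact: le_trans (xC M) HM.
Qed.

End RealNormConvergence.

Section NonnegativeSeries.
Context {R : realType}.
Implicit Types (t : nat -> R) (S K : R).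

Definition remainder t S (M : nat) : R := S - \sum_(i < M) t i.

(** Convergence of the partial sums of [t] to [S], phrased with the remainders
    because these serve as moduli of convergence in the Hilbert space. *)
Definition nonneg_series t S : Prop :=
  [/\ forall i, 0 <= t i, forall M, 0 <= remainder t S M &
      forall d, 0 < d -> exists M, remainder t S M <= d].

Lemma nonneg_series_ex {t K} :
  (forall i, 0 <= t i) -> (forall M, \sum_(i < M) t i <= K) ->
  exists2 S, S <= K & nonneg_series t S.
Proof.
move=> t0 tK; pose A := [set \sum_(i < M) t i | M in [set: nat]].
have A0 : A !=set0 by exists (\sum_(i < 0) t i); exists 0.
have Aub : ubound A K by move=> _ [M _ <-].
have hA : has_sup A by split => //; exists K.
exists (sup A); first exact: ge_sup.
split=> // [M|d d0]; first by rewrite subr_ge0; apply: sup_upper_bound => //; exists M.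
have [_ [M _ <-] HM] := sup_adherent d0 hA; exists M; rewrite /remainder; lra.
Qed.

Lemma sum_le_remainder {t S} m n : nonneg_series t S -> (m <= n)%N ->
  \sum_(m <= i < n) t i <= remainder t S m.
Proof.
move=> [_ tS _] mn; rewrite /remainder lerBrDl -!(big_mkord xpredT t) -big_cat_nat//=.
by rewrite big_mkord -subr_ge0; exact: tS.
Qed.

Lemma remainder_nonincreasing {t S} m n : nonneg_series t S -> (m <= n)%N ->
  remainder t S n <= remainder t S m.
Proof.
move=> [t0 _ _] mn; rewrite /remainder lerB// -!(big_mkord xpredT t).
by rewrite (big_cat_nat _ mn)//= lerDl sumr_ge0.
Qed.

End NonnegativeSeries.

Section RieszFischer.
Context {R : realType} {H : completeNormedModType R[i]}.
Variable dot : {dot H for (@Num.conj R[i])}.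
Hypothesis Hdot : norm_of_dot dot.
Variable e : nat -> H.
Hypothesis oe : forall j k : nat, dot (e j) (e k) = (j == k)%:R.

Lemma orthonormal_prefix N : orthonormal_family dot (fun i : 'I_N => e i).
Proof. by move=> i j; rewrite oe. Qed.

Lemma rnorm_sum_nat (c : nat -> R[i]) m n :
  rnorm (\sum_(m <= i < n) c i *: e i) ^+ 2 = \sum_(m <= i < n) cabs (c i) ^+ 2.
Proof.
rewrite -{1}[m]add0n -{2}[m]add0n !big_addn !big_mkord.
by apply: (rnorm_combination dot Hdot (fun i : 'I_(n - m) => e (i + m)%N)) => i j;
  rewrite oe eqn_add2r.
Qed.

(** The partial sums of the orthogonal series are Cauchy, with the square root of
    the remainder of the squared coefficients as modulus. *)
Lemma riesz_fischer (c : nat -> R[i]) (C : R) : 0 <= C ->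
  (forall N, \sum_(k < N) cabs (c k) ^+ 2 <= C ^+ 2) ->
  exists2 v, forall k, dot v (e k) = c k & rnorm v <= C.
Proof.
move=> C0 cC.
have [S SC tS] := nonneg_series_ex (fun i => sqr_ge0 (cabs (c i))) cC.
set t := fun i => cabs (c i) ^+ 2 in tS.
pose u n := \sum_(0 <= k < n) c k *: e k.
pose delta M := Num.sqrt (remainder t S M).
have delta_small d : 0 < d -> exists M, delta M <= d.
  move=> d0; have [_ _ small] := tS; have [M HM] := small (d ^+ 2) (exprn_gt0 2 d0); exists M.
  by rewrite -[d]ger0_norm ?(ltW d0)// -sqrtr_sqr ler_wsqrtr.
have udelta m n : (m <= n)%N -> rnorm (u n - u m) <= delta m.
  move=> mn; rewrite /u (big_cat_nat _ mn)//= addrAC subrr add0r.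
  rewrite -[leLHS]ger0_norm ?rnorm_ge0// -sqrtr_sqr ler_wsqrtr//.
  by rewrite rnorm_sum_nat; exact: sum_le_remainder.
have [v vu] := cauchy_modulus u delta delta_small udelta.
exists v => [k|]; last first.
  apply: rnorm_le_small => d d0; have [M HM] := delta_small d d0.
  rewrite -[v](subrK (u M)) addrC; apply: le_trans (ler_rnormD _ _) _.
  apply: lerD; last exact: le_trans (vu M) HM.
  rewrite -ler_sqr ?nnegrE ?rnorm_ge0// rnorm_sum_nat big_mkord; exact: cC.
apply/eqP; rewrite -subr_eq0; apply/eqP.
apply: (@rnorm0_eq0 R (R[i]^o)); apply: le_anti; rewrite rnorm_ge0 andbT.
apply/ler_addgt0Pr => d d0; rewrite add0r.
have [M HM] := delta_small d d0.
pose n := maxn M k.+1.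
have dn : delta n <= d.
  apply: le_trans HM; rewrite ler_wsqrtr//.
  by apply: (remainder_nonincreasing _ _ tS); exact: leq_maxl.
have -> : c k = dot (u n) (e k).
  rewrite /u big_mkord dot_suml.
  have kn : (k < n)%N by exact: leq_maxr.
  rewrite (bigD1 (Ordinal kn))//= big1 => [|j jk].
    by rewrite dotZl oe eqxx mulr1 addr0.
  by rewrite dotZl oe; move: jk; rewrite -val_eqE/= => /negbTE ->; rewrite mulr0.
rewrite -linearBl; apply: le_trans (cauchy_schwarz _ Hdot _ _) _.
rewrite (rnorm1 dot Hdot (e k)) ?oe ?eqxx// mulr1.
exact: le_trans (vu n) dn.
Qed.

End RieszFischer.

(** * Sums of rank-one operators *)

Section NuclearSeries.
Context {R : realType} {H : completeNormedModType R[i]}.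
Variable dot : {dot H for (@Num.conj R[i])}.
Hypothesis Hdot : norm_of_dot dot.
Implicit Types (T : {linear H -> H}) (g h : nat -> H).

(** A nuclear representation of [T] by rank-one operators, with the remainders
    of the scalar series [t] as error bounds in operator norm. *)
Definition nuclear_sum T g h t (S : R) : Prop :=
  forall M z, rnorm (T z - \sum_(i < M) dot z (g i) *: h i) <=
    remainder t S M * rnorm z.

Lemma rnorm_rank_one_sum g h (t : nat -> R) m n z :
  (forall i, rnorm (g i) * rnorm (h i) <= t i) ->
  rnorm (\sum_(m <= i < n) dot z (g i) *: h i)
    <= (\sum_(m <= i < n) t i) * rnorm z.
Proof.
move=> ght; apply: le_trans (ler_rnorm_sum _ _ _ _) _; rewrite mulr_suml.
apply: ler_sum => i _; rewrite rnormZ.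
apply: (@le_trans _ _ (rnorm z * rnorm (g i) * rnorm (h i))).
  by apply: ler_wpM2r; rewrite ?rnorm_ge0//; exact: cauchy_schwarz.
by rewrite -mulrA mulrC; apply: ler_wpM2r; rewrite ?rnorm_ge0.
Qed.

(** The series converges absolutely at every point; linearity of the sum follows
    from that of the partial sums, since the remainders are arbitrarily small. *)
Lemma nuclear_operator {g h} {t : nat -> R} {S : R} :
  (forall i, rnorm (g i) * rnorm (h i) <= t i) ->
  nonneg_series t S -> exists T, nuclear_sum T g h t S.
Proof.
move=> ght tS; have [t0 eps0 eps_small] := tS.
set eps := remainder t S in eps0 eps_small.
pose B M z := \sum_(i < M) dot z (g i) *: h i.
have /choice[F HF] : forall z, exists l, forall M, rnorm (l - B M z) <= eps M * rnorm z.
  move=> z; apply: cauchy_modulus => [d d0|m n mn].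
    have [M HM] := small_multiple (rnorm_ge0 z) d0 eps_small.
    by exists M; rewrite mulrC.
  rewrite /B -!(big_mkord xpredT (fun i => dot z (g i) *: h i)) (big_cat_nat _ mn)//=.
  rewrite addrAC subrr add0r; apply: le_trans (rnorm_rank_one_sum _ _ t _ _ _ ght) _.
  by apply: ler_wpM2r; rewrite ?rnorm_ge0//; exact: sum_le_remainder.
have linF : linear F.
  move=> a x y; apply/eqP; rewrite -subr_eq0; apply/eqP.
  apply: (rnorm_eq0_small _ (rnorm (a *: x + y) + (cabs a * rnorm x + rnorm y)) eps).
  - exact: eps_small.
  - by rewrite !addr_ge0 ?mulr_ge0 ?rnorm_ge0.
  move=> M.
  have BE : B M (a *: x + y) = a *: B M x + B M y.
    rewrite /B scaler_sumr -big_split/=; apply: eq_bigr => i _.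
    by rewrite linearDl/= dotZl scalerDl scalerA.
  have -> : F (a *: x + y) - (a *: F x + F y) =
      (F (a *: x + y) - B M (a *: x + y)) - (a *: (F x - B M x) + (F y - B M y)).
    rewrite BE scalerBr [_ - _ + (_ - _)]addrACA -opprD.
    by rewrite [in RHS]opprB addrA subrK.
  rewrite mulrDl; apply: le_trans (ler_rnormB _ _) _; apply: lerD.
    by rewrite mulrC.
  rewrite mulrDl; apply: le_trans (ler_rnormD _ _) _; apply: lerD.
    by rewrite rnormZ -mulrA; apply: ler_wpM2l; rewrite ?rnorm_ge0// mulrC.
  by rewrite mulrC.
pose T : {linear H -> H} := HB.pack F (GRing.isLinear.Build _ _ _ _ F linF).
by exists T => M z; exact: HF.
Qed.

Lemma nuclear_bounded {T g h} {t : nat -> R} {S : R} :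
  nonneg_series t S -> nuclear_sum T g h t S -> bounded_op T.
Proof.
move=> [_ eps0 _] TS; apply: (@le_lt_trans _ _ (remainder t S 0)%:E); last exact: ltry.
apply: ge_ereal_sup => _ [x /= x1 <-]; rewrite lee_fin.
have := TS 0 x; rewrite big_ord0 subr0 => /le_trans; apply.
have x1' : rnorm x <= 1 by rewrite -lecR -rnormE.
by rewrite -[leRHS]mulr1; apply: ler_wpM2l.
Qed.

Import ArrowAsProduct.

(** The image of the unit ball lies in the image of a product of segments, for
    the real and imaginary parts of the coefficients [dot z (g i)], under the
    sum of the series, which is continuous for the product topology. *)
Lemma nuclear_compact {T g h} {t : nat -> R} {S : R} :
  (forall i, rnorm (g i) * rnorm (h i) <= t i) ->
  nonneg_series t S -> nuclear_sum T g h t S -> compact_op T.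
Proof.
move=> ght tS TS; have [t0 del0 del_small] := tS.
set del := remainder t S in del0 del_small.
pose A (ib : nat * bool) : set R := `[- rnorm (g ib.1), rnorm (g ib.1)]%classic.
pose X := [set xi : forall ib : nat * bool, R | forall ib, A ib (xi ib)].
have cX : compact X by apply: (@tychonoff _ (fun=> R)) => ib; exact: segment_compact.
pose c (xi : nat * bool -> R) i : R[i] := Complex (xi (i, false)) (xi (i, true)).
have c_le xi i : cabs (c xi i) <= `|xi (i, false)| + `|xi (i, true)|.
  have -> : c xi i = (xi (i, false))%:C + Complex 0 1 * (xi (i, true))%:C.
    exact: complexE.
  apply: le_trans (@ler_rnormD R (R[i]^o) _ _) _.
  apply: lerD; first by rewrite cabs_real.
  by rewrite cabsM cabs_real cabsE /= expr0n/= add0r expr1n sqrtr1 mul1r.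
pose B M xi := \sum_(i < M) c xi i *: h i.
have /choice[F HF] : forall xi, exists l, X xi ->
    forall M, rnorm (l - B M xi) <= 2 * del M.
  move=> xi; have [Xxi|nX] := pselect (X xi); last by exists 0.
  suff [l Hl] : exists l, forall M, rnorm (l - B M xi) <= 2 * del M by exists l.
  apply: cauchy_modulus => [d d0|m n mn]; first exact: small_multiple.
  rewrite /B -!(big_mkord xpredT (fun i => c xi i *: h i)) (big_cat_nat _ mn)//=.
  rewrite addrAC subrr add0r; apply: le_trans (ler_rnorm_sum _ _ _ _) _.
  apply: (@le_trans _ _ (2 * \sum_(m <= i < n) t i)); last first.
    by rewrite ler_pM2l//; exact: sum_le_remainder.
  rewrite mulr_sumr; apply: ler_sum => i _; rewrite rnormZ.
  apply: (@le_trans _ _ (2 * rnorm (g i) * rnorm (h i))); last first.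
    by rewrite -mulrA ler_pM2l.
  apply: ler_wpM2r; first exact: rnorm_ge0.
  have abs_le b : `|xi (i, b)| <= rnorm (g i).
    by have := Xxi (i, b); rewrite /A /= in_itv/= ler_norml.
  by apply: le_trans (c_le xi i) _; rewrite mulr2n mulrDl !mul1r lerD.
(* Finitely many coordinates control the partial sum, and the remainder is
   uniformly small on [X]. *)
have cF : {within X, continuous F}.
  apply/subspace_continuousP => xi Xxi; apply/rnorm_cvgP => d d0.
  have d4 : 0 < d / 2 by lra.
  have [M HM] := small_multiple (ltW (ltr0Sn R 3)) d4 del_small.
  pose Q := \sum_(i < M) 2 * rnorm (h i).
  have Q0 : 0 <= Q by apply: sumr_ge0 => i _; rewrite mulr_ge0 ?rnorm_ge0.
  have r0 : 0 < d / 2 / (Q + 1) by rewrite divr_gt0//; lra.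
  have near_coord : \forall eta \near within X (nbhs xi),
      forall ib : 'I_M * bool, `|xi (val ib.1, ib.2) - eta (val ib.1, ib.2)| <= d / 2 / (Q + 1).
    apply: filter_forall => ib; apply: cvg_within.
    have := @proj_continuous _ (fun=> R) (val ib.1, ib.2) xi.
    by move/cvgrPdist_le => /(_ _ r0).
  have inX : \forall eta \near within X (nbhs xi), X eta by exact: withinT.
  near=> eta.
  have Xeta : X eta by near: eta.
  have Heta : forall ib : 'I_M * bool,
    `|xi (val ib.1, ib.2) - eta (val ib.1, ib.2)| <= d / 2 / (Q + 1) by near: eta.
  have -> : F xi - F eta = (F xi - B M xi) - (F eta - B M eta) + (B M xi - B M eta).
    rewrite [X in _ = X + _](_ : _ = (F xi - F eta) - (B M xi - B M eta)).
      by rewrite subrK.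
    by rewrite !opprD !opprK addrACA.
  have h1 : rnorm (F xi - B M xi - (F eta - B M eta)) <= 4 * del M.
    apply: le_trans (ler_rnormB _ _) _.
    by have := HF xi Xxi M; have := HF eta Xeta M; lra.
  have h2 : rnorm (B M xi - B M eta) <= d / 2.
    rewrite /B -sumrB; apply: le_trans (ler_rnorm_sum _ _ _ _) _.
    apply: (@le_trans _ _ (\sum_(i < M) d / 2 / (Q + 1) * (2 * rnorm (h i)))).
      apply: ler_sum => i _; rewrite -scalerBl rnormZ mulrA.
      apply: ler_wpM2r; first exact: rnorm_ge0.
      have -> : c xi i - c eta i = c (fun ib => xi ib - eta ib) i by [].
      apply: le_trans (c_le _ i) _.
      have := Heta (i, false); have := Heta (i, true) => /= a b; lra.
    rewrite -mulr_sumr -/Q mulrAC ler_pdivrMr; last lra.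
    by rewrite ler_pM2l//; lra.
  by apply: le_trans (ler_rnormD _ _) _; lra.
apply: precompact_subset (compact_precompact (@norm_hausdorff _ _) (continuous_compact cF cX)).
move=> _ [z /= z1 <-].
have z1' : rnorm z <= 1 by rewrite -lecR -rnormE.
pose xi (ib : nat * bool) : R :=
  if ib.2 then complex.Im (dot z (g ib.1)) else complex.Re (dot z (g ib.1)).
have cxi i : c xi i = dot z (g i) by rewrite /c /xi /=; case: (dot z (g i)).
have Xxi : X xi.
  move=> [i b]; rewrite /A /= in_itv/= -ler_norml.
  have zg : cabs (dot z (g i)) <= rnorm (g i).
    apply: le_trans (cauchy_schwarz _ Hdot _ _) _.
    by rewrite -[leRHS]mul1r; apply: ler_wpM2r; rewrite ?rnorm_ge0.
  apply: le_trans zg; rewrite cabsE /xi/=; case: (dot z (g i)) => a b' /=.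
  rewrite -sqrtr_sqr; case: b => /=; apply: ler_wsqrtr; rewrite ?lerDl ?lerDr; exact: sqr_ge0.
exists xi => //; apply/eqP; rewrite -subr_eq0; apply/eqP.
apply: (rnorm_eq0_small _ 3 del del_small) => // M.
have -> : F xi - T z = (F xi - B M xi) - (T z - B M xi).
  by rewrite opprB addrA subrK.
apply: le_trans (ler_rnormB _ _) _.
have -> : B M xi = \sum_(i < M) dot z (g i) *: h i.
  by apply: eq_bigr => i _; rewrite cxi.
have -> : 3 * del M = 2 * del M + del M by ring.
apply: lerD.
  have -> : \sum_(i < M) dot z (g i) *: h i = B M xi.
    by apply: eq_bigr => i _; rewrite cxi.
  exact: HF.
by apply: le_trans (TS M z) _; rewrite -[leRHS]mulr1; apply: ler_wpM2l.
Unshelve. all: by end_near. Qed.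

End NuclearSeries.

(** * The mean value inequality for divided differences *)

Section MeanValue.
Context {R : realType}.
Implicit Types (f : R -> R[i]).

(** Direct argument for vector values: the supremum of the points [x] at which
    the increment from [a] is at most [(C + d) * (x - a)] is such a point itself, and
    cannot lie before [b]. *)
Lemma mean_value_inequality f (a b C : R) : a <= b -> 0 <= C ->
  (forall x, a <= x <= b -> forall d, 0 < d -> exists2 r, 0 < r &
     forall y, a <= y <= b -> `|y - x| < r ->
       cabs (f y - f x) <= (C + d) * `|y - x|) ->
  cabs (f b - f a) <= C * (b - a).
Proof.
move=> ab C0 loc; apply/ler_addgt0Pr => d' d'0.
pose d := d' / (b - a + 1).
have ba1 : 0 < b - a + 1 by rewrite ltr_wpDl// subr_ge0.
have d0 : 0 < d by rewrite divr_gt0.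
pose A := [set x | a <= x <= b /\ cabs (f x - f a) <= (C + d) * (x - a)].
have Aa : A a by split; rewrite ?lexx ?ab// !subrr mulr0 rnorm0.
have Aub : ubound A b by move=> x [/andP[]].
have hA : has_sup A by split; [exists a|exists b].
set s := sup A.
have as_ : a <= s by exact: sup_upper_bound.
have sb : s <= b by apply: ge_sup => //; exists a.
have sab : a <= s <= b by rewrite as_.
have [r r0 Hr] := loc s sab d d0.
have As : cabs (f s - f a) <= (C + d) * (s - a).
  have [x [xab Ax] xs] := sup_adherent r0 hA.
  have xs' : x <= s by apply: sup_upper_bound.
  have := Hr x xab; rewrite distrC ger0_norm ?subr_ge0// => /(_ _) H.
  have {}H : cabs (f x - f s) <= (C + d) * (s - x) by apply: H; rewrite -/s in xs; lra.
  have -> : f s - f a = - (f x - f s) + (f x - f a) by rewrite opprB addrA subrK.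
  apply: le_trans (@ler_rnormD R (R[i]^o) _ _) _.
  by rewrite rnormN; lra.
have sbE : s = b.
  apply/eqP; rewrite eq_le sb leNgt; apply/negP => slb.
  pose y := Order.min b (s + r / 2).
  have sy : s < y by rewrite lt_min slb/= ltrDl divr_gt0.
  have yb : y <= b by rewrite ge_min lexx.
  have ysr : y <= s + r / 2 by rewrite ge_min lexx orbT.
  have Ay : A y.
    have yab : a <= y <= b by rewrite yb (le_trans as_ (ltW sy)).
    split=> //; have := Hr y yab; rewrite ger0_norm ?subr_ge0 ?(ltW sy)// => H.
    have {}H : cabs (f y - f s) <= (C + d) * (y - s) by apply: H; lra.
    have -> : f y - f a = (f y - f s) + (f s - f a) by rewrite addrA subrK.
    by apply: le_trans (@ler_rnormD R (R[i]^o) _ _) _; lra.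
  by have := sup_upper_bound hA Ay; rewrite -/s leNgt sy.
rewrite sbE in As; apply: le_trans As _; rewrite mulrDl lerD2l /d.
by rewrite mulrAC ler_pdivrMr// ler_pM2l// lerDl.
Qed.

Lemma deriv11_local {f} {x d : R} : C1_11 f -> -1 <= x <= 1 -> 0 < d ->
  exists2 r, 0 < r & forall y, -1 <= y <= 1 -> `|y - x| < r ->
    cabs (f y - f x) <= (cabs (deriv11 f x) + d) * `|y - x|.
Proof.
move=> [df _] x11 d0; have x11' : x \in `[-1, 1] by rewrite in_itv.
have /(@rnorm_cvgP R (R[i]^o)) /(_ d d0) := df x x11'.
rewrite /within/= => /nbhs_ballP[r /= r0 Hr]; exists r => // y y11 yr.
have [->|yx] := eqVneq y x; first by rewrite !subrr rnorm0 normr0 mulr0.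
have y11' : y \in `[-1, 1] by rewrite in_itv.
have xyr : ball x r y by rewrite -ball_normE /= distrC.
have {}Hr := Hr y xyr yx y11'.
have yx0 : (y - x)%:C != 0 :> R[i] by rewrite (inj_eq (@complexI _)) subr_eq0.
have -> : f y - f x = diff_quot f x y * (y - x)%:C by rewrite /diff_quot divfK.
rewrite cabsM cabs_real; apply: ler_wpM2r => //.
have -> : diff_quot f x y = deriv11 f x - (deriv11 f x - diff_quot f x y).
  by rewrite opprB addrC subrK.
by apply: le_trans (@ler_rnormB R (R[i]^o) _ _) _; rewrite lerD2l.
Qed.

(** The weighted supremum says nothing about the derivative at 0; there it vanishes
    by continuity. *)
Lemma deriv11_le {f} {alpha L : R} : C1_11 f -> 0 < alpha -> 0 <= L ->
  (forall t, 0 < `|t| <= 1 -> cabs (deriv11 f t) <= L * `|t| `^ alpha) ->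
  forall t, `|t| <= 1 -> cabs (deriv11 f t) <= L * `|t| `^ alpha.
Proof.
move=> [_ cdf] alpha0 L0 HL t t1; have [t0|t0] := eqVneq t 0; last first.
  by apply: HL; rewrite normr_gt0 t0.
rewrite t0 normr0 powR0 ?gt_eqF// mulr0; apply/ler_addgt0Pr => d d0; rewrite add0r.
have z11 : `[-1, 1]%classic (0 : R) by rewrite /= in_itv/= lerN10 ler01.
have /subspace_continuousP /(_ 0 z11) /(@rnorm_cvgP R (R[i]^o)) := cdf.
have d2 : 0 < d / 2 by lra.
move=> /(_ _ d2); rewrite /within/= => /nbhs_ballP[r /= r0 Hr].
have L1 : 0 < L + 1 by lra.
(* A point [s] so close to 0 that [L * s ^ alpha <= d / 2]. *)
pose w := d / 2 / (L + 1).
have w0 : 0 < w by rewrite divr_gt0.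
have u0 : 0 < w `^ alpha^-1 by exact: powR_gt0.
pose s := Order.min (Order.min 1 (r / 2)) (w `^ alpha^-1).
have s0 : 0 < s by rewrite !lt_min ltr01 u0 divr_gt0.
have s1 : s <= 1 by rewrite !ge_min lexx.
have sr : s <= r / 2 by rewrite !ge_min lexx !orbT.
have su : s <= w `^ alpha^-1 by rewrite !ge_min lexx !orbT.
have br : ball 0 r s by rewrite -ball_normE /= sub0r normrN gtr0_norm//; lra.
have s11 : `[-1, 1]%classic s by rewrite /= in_itv/= s1 andbT (le_trans (lerN10 _) (ltW s0)).
have H1 : cabs (deriv11 f 0 - deriv11 f s) <= d / 2 := Hr s br s11.
have H2 := HL s; rewrite gtr0_norm// s0 s1 in H2; have {}H2 := H2 isT.
have sw : s `^ alpha <= w.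
  have -> : w = (w `^ alpha^-1) `^ alpha.
    by rewrite -powRrM mulVf ?gt_eqF// powRr1// ltW.
  by apply: ge0_ler_powR; rewrite ?nnegrE ?(ltW alpha0) ?(ltW s0) ?(ltW u0).
have H3 : L * s `^ alpha <= d / 2.
  apply: le_trans (ler_wpM2l L0 sw) _.
  by rewrite /w mulrA ler_pdivrMr// mulrC ler_wpM2l ?(ltW d2)// lerDl.
have -> : deriv11 f 0 = (deriv11 f 0 - deriv11 f s) + deriv11 f s by rewrite subrK.
by apply: le_trans (@ler_rnormD R (R[i]^o) _ _) _; lra.
Qed.

(** On the segment between the two points the derivative is at most its bound at
    the end of larger modulus. *)
Lemma divided_difference_le {f} {alpha L : R} {lambda : R^nat} :
  C1_11 f -> 0 < alpha -> 0 <= L ->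
  (forall t, 0 < `|t| <= 1 -> cabs (deriv11 f t) <= L * `|t| `^ alpha) ->
  (forall j, `|lambda j| <= 1) ->
  forall j k, cabs (divided_difference f lambda j k) <=
    L * Order.max `|lambda j| `|lambda k| `^ alpha.
Proof.
move=> Cf alpha0 L0 HL lam1 j k.
have HL' := deriv11_le Cf alpha0 L0 HL.
have pow_mono a b : 0 <= a -> a <= b -> L * a `^ alpha <= L * b `^ alpha.
  move=> a0 ab; apply: ler_wpM2l => //; apply: ge0_ler_powR; rewrite ?nnegrE ?(ltW alpha0)//.
  exact: le_trans ab.
have key x y : x < y -> `|x| <= 1 -> `|y| <= 1 ->
    cabs (f y - f x) <= L * Order.max `|x| `|y| `^ alpha * (y - x).
  move=> xy x1 y1; apply: mean_value_inequality; first exact: ltW.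
    by rewrite mulr_ge0// powR_ge0.
  move: (x1) (y1); rewrite !ler_norml => /andP[x1' _] /andP[_ y1'].
  move=> c cxy d d0; have /andP[xc cy] := cxy.
  have c11 : -1 <= c <= 1 by apply/andP; split; lra.
  have [r r0 Hr] := deriv11_local Cf c11 d0; exists r => // z /andP[xz zy] zr.
  apply: le_trans (Hr z _ zr) _; first by apply/andP; split; lra.
  apply: ler_wpM2r => //; rewrite lerD2r; apply: le_trans (HL' c _) _.
    by rewrite ler_norml.
  apply: pow_mono => //; rewrite le_max.
  have [c0|c0] := leP 0 c.
    by apply/orP; right; rewrite ger0_norm// (le_trans cy)// ler_norm.
  apply/orP; left; rewrite ltr0_norm// ltr0_norm; lra.
rewrite /divided_difference; case: eqVneq => [jk|jk].
  by rewrite -jk maxxx; apply: HL'.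
rewrite cabsM; set q := (_%:C)^-1.
have -> : cabs q = `|lambda j - lambda k|^-1.
  by rewrite /q -fmorphV cabs_real normfV.
have jk0 : 0 < `|lambda j - lambda k| by rewrite normr_gt0 subr_eq0.
rewrite ler_pdivrMr//; have [lt|gt|//] := ltrgtP (lambda j) (lambda k).
- have := key _ _ lt (lam1 j) (lam1 k).
  rewrite -[f _ - f _ in X in X -> _]opprB rnormN.
  exact.
- have := key _ _ gt (lam1 k) (lam1 j).
  by rewrite maxC.
- by move=> E; rewrite E eqxx in jk.
Qed.

Lemma Lalpha_lt_pinfty {alpha : R} {f} : (Lalpha alpha f < +oo)%E ->
  exists L : R, [/\ 0 <= L, Lalpha alpha f = L%:E &
    forall t, 0 < `|t| <= 1 -> cabs (deriv11 f t) <= L * `|t| `^ alpha].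
Proof.
move=> Lfin.
have le_L t : 0 < `|t| <= 1 -> ((rnorm (deriv11 f t) / `|t| `^ alpha)%:E <= Lalpha alpha f)%E.
  by move=> t1; apply: ereal_sup_ubound; exists t.
have one : 0 < `|1 : R| <= 1 by rewrite normr1 ltr01 lexx.
have L0 : (0 <= Lalpha alpha f)%E.
  by apply: le_trans (le_L 1 one); rewrite lee_fin divr_ge0 ?rnorm_ge0 ?powR_ge0.
have LE : Lalpha alpha f = (fine (Lalpha alpha f))%:E by rewrite fineK// ge0_fin_numE.
exists (fine (Lalpha alpha f)); split=> // [|t /[dup] t01 /andP[t0 _]].
  exact: fine_ge0.
by have := le_L t t01; rewrite LE lee_fin ler_pdivrMr// powR_gt0.
Qed.

End MeanValue.

(** * Bounded operators and their matrices *)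

Section OperatorNorm.
Context {R : realType} {H : completeNormedModType R[i]}.

Lemma op_norm_lt_pinfty {A : {linear H -> H}} : bounded_op A ->
  exists C : R, [/\ 0 <= C, op_norm A = C%:E & forall x, rnorm (A x) <= C * rnorm x].
Proof.
move=> Abd.
have le_op (x : H) : `|x| <= 1 -> ((rnorm (A x))%:E <= op_norm A)%E.
  by move=> x1; apply: ereal_sup_ubound; exists x.
have A0 : (0 <= op_norm A)%E.
  by have := le_op 0; rewrite normr0 linear0 rnorm0; apply; exact: ler01.
have AE : op_norm A = (fine (op_norm A))%:E by rewrite fineK// ge0_fin_numE.
exists (fine (op_norm A)); split=> // [|x]; first exact: fine_ge0.
have [->|x0] := eqVneq x 0; first by rewrite linear0 !rnorm0 mulr0.
have n0 : 0 < rnorm x by rewrite -ltcR -rnormE normr_gt0.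
have : `|((rnorm x)^-1)%:C *: x| <= 1.
  by rewrite rnormE rnormZ cabs_real gtr0_norm ?invr_gt0// mulVf ?gt_eqF// lexx.
move=> /le_op; rewrite AE lee_fin linearZ/= rnormZ cabs_real gtr0_norm ?invr_gt0//.
by rewrite ler_pdivrMl// mulrC.
Qed.

Variable dot : {dot H for (@Num.conj R[i])}.
Hypothesis Hdot : norm_of_dot dot.
Variable e : nat -> H.
Hypothesis He : orthonormal_basis dot e.

Let oe : forall j k, dot (e j) (e k) = (j == k)%:R := He.1.

Lemma rnorm_basis k : rnorm (e k) = 1.
Proof. by apply: (rnorm1 dot Hdot); rewrite oe eqxx. Qed.

Lemma matrix_column_le {A : {linear H -> H}} {C : R} k N :
  (forall x, rnorm (A x) <= C * rnorm x) ->
  \sum_(j < N) cabs (dot (A (e k)) (e j)) ^+ 2 <= C ^+ 2.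
Proof.
move=> AC; have AeC : rnorm (A (e k)) <= C.
  by have := AC (e k); rewrite rnorm_basis mulr1.
apply: le_trans (bessel dot Hdot _ (orthonormal_prefix dot e oe N)) _.
by rewrite ler_sqr ?nnegrE ?rnorm_ge0// (le_trans _ AeC)// rnorm_ge0.
Qed.

(** [A] is tested on the combination of the [e k] whose coefficients are the
    conjugates of the row itself, so that no adjoint of [A] is involved. *)
Lemma matrix_row_le {A : {linear H -> H}} {C : R} j N : 0 <= C ->
  (forall x, rnorm (A x) <= C * rnorm x) ->
  \sum_(k < N) cabs (dot (A (e k)) (e j)) ^+ 2 <= C ^+ 2.
Proof.
move=> C0 AC; pose x := \sum_(k < N) Num.conj (dot (A (e k)) (e j)) *: e k.
have xx : rnorm x ^+ 2 = \sum_(k < N) cabs (dot (A (e k)) (e j)) ^+ 2.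
  rewrite (rnorm_combination dot Hdot _ _ (orthonormal_prefix dot e oe N)).
  by apply: eq_bigr => k _; rewrite cabs_conj.
have Axj : dot (A x) (e j) = (rnorm x ^+ 2)%:C.
  rewrite xx /x linear_sum dot_suml rmorph_sum/=; apply: eq_bigr => k _.
  by rewrite linearZ/= dotZl mulrC mul_conj_cabs.
have : rnorm x ^+ 2 <= C * rnorm x.
  rewrite -[leLHS]ger0_norm ?sqr_ge0// -cabs_real -Axj.
  apply: le_trans (cauchy_schwarz _ Hdot _ _) _.
  by rewrite rnorm_basis mulr1.
rewrite -xx => H1; have [x0|x0] := eqVneq (rnorm x) 0.
  by rewrite x0 expr0n/= sqr_ge0.
have xp : 0 < rnorm x by rewrite lt_neqAle eq_sym x0 rnorm_ge0.
rewrite ler_sqr ?nnegrE ?rnorm_ge0//.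
by move: H1; rewrite expr2 ler_pM2r.
Qed.

Lemma eq_bounded_op {A B : {linear H -> H}} : bounded_op A -> bounded_op B ->
  (forall j k, dot (A (e k)) (e j) = dot (B (e k)) (e j)) -> forall x, A x = B x.
Proof.
move=> /op_norm_lt_pinfty[C [C0 _ AC]] /op_norm_lt_pinfty[D [D0 _ BD]] AB.
have zero y : (forall j, dot y (e j) = 0) -> y = 0.
  move=> ye; have /rnorm_cvgP ys := He.2 y.
  apply: rnorm0_eq0; apply: le_anti; rewrite rnorm_ge0 andbT.
  apply: rnorm_le_small => d d0; rewrite add0r.
  have [N _ /(_ N (leqnn N))] := ys d d0.
  by rewrite /series/= big1 ?subr0// => j _; rewrite ye scale0r.
have ABe k : A (e k) = B (e k).
  apply/eqP; rewrite -subr_eq0; apply/eqP; apply: zero => j.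
  by rewrite linearBl/= AB subrr.
move=> x; apply/eqP; rewrite -subr_eq0; apply/eqP.
apply: rnorm0_eq0; apply: le_anti; rewrite rnorm_ge0 andbT.
apply: rnorm_le_small => d d0; rewrite add0r.
have CD1 : 0 < C + D + 1 by lra.
have /rnorm_cvgP /(_ _ (divr_gt0 d0 CD1)) [N _ /(_ N (leqnn N))] := He.2 x.
set s := series _ N => xs.
have ABs : A s = B s.
  rewrite /s /series/= !linear_sum; apply: eq_bigr => j _.
  by rewrite !linearZ/= ABe.
have -> : A x - B x = A (x - s) - B (x - s).
  by rewrite linearB/= [B (x - s)]linearB/= ABs opprB addrA subrK.
apply: le_trans (ler_rnormB _ _) _.
apply: (@le_trans _ _ ((C + D) * rnorm (x - s))); first by rewrite mulrDl lerD.
apply: le_trans (ler_wpM2l _ xs) _; first by rewrite addr_ge0.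
by rewrite mulrA ler_pdivrMr// mulrC ler_wpM2l ?(ltW d0)// lerDl.
Qed.

Lemma sum_double {V : nmodType} (F : nat -> V) N :
  \sum_(i < N.*2) F i = \sum_(i < N) (F i.*2 + F i.*2.+1).
Proof.
elim: N => [|N IH]; first by rewrite !big_ord0.
by rewrite doubleS !big_ord_recr/= IH addrA.
Qed.

(** Every entry [(j, k)] is assigned to row [j] or to column [k], whichever has the
    larger weight.  What remains of row [j] has [l^2] norm at most [C * w j], since
    the multiplier is at most [w j] there, and defines a rank-one operator with
    range spanned by [e j]; columns are treated in the same way.  Rows get the even
    indices and columns the odd ones. *)
Lemma schur_rank_one_terms {M : nat -> nat -> R[i]} {w : nat -> R}
    {A : {linear H -> H}} {C : R} :
  (forall j, 0 <= w j) -> (forall j k, cabs (M j k) <= Order.max (w j) (w k)) ->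
  0 <= C -> (forall x, rnorm (A x) <= C * rnorm x) ->
  exists g h : nat -> H,
    (forall i, rnorm (g i) * rnorm (h i) <= C * w i./2) /\
    (forall j k N, (j < N)%N -> (k < N)%N ->
       \sum_(i < N.*2) dot (e k) (g i) * dot (h i) (e j) =
       M j k * dot (A (e k)) (e j)).
Proof.
move=> w0 Mw C0 AC.
pose a j k := M j k * dot (A (e k)) (e j).
have row_ex j : exists r, (forall k, dot r (e k) =
    if w k <= w j then Num.conj (a j k) else 0) /\ rnorm r <= C * w j.
  have [||r r1 r2] := riesz_fischer dot Hdot e oe
    (fun k => if w k <= w j then Num.conj (a j k) else 0) (C * w j).
  - by rewrite mulr_ge0.
  - move=> N; apply: (@le_trans _ _ (w j ^+ 2 * \sum_(k < N) cabs (dot (A (e k)) (e j)) ^+ 2)).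
      rewrite mulr_sumr; apply: ler_sum => k _; case: (leP (w k) (w j)) => kj; last first.
        by rewrite rnorm0 expr0n/= mulr_ge0// sqr_ge0.
      rewrite -exprMn cabs_conj cabsM ler_sqr ?nnegrE ?mulr_ge0 ?rnorm_ge0//.
      apply: ler_wpM2r; first exact: rnorm_ge0.
      by have := Mw j k; rewrite max_l.
    by rewrite exprMn mulrC ler_wpM2r ?sqr_ge0//; exact: matrix_row_le.
  by exists r.
have col_ex k : exists c, (forall j, dot c (e j) =
    if w k <= w j then 0 else a j k) /\ rnorm c <= C * w k.
  have [||c c1 c2] := riesz_fischer dot Hdot e oe
    (fun j => if w k <= w j then 0 else a j k) (C * w k).
  - by rewrite mulr_ge0.
  - move=> N; apply: (@le_trans _ _ (w k ^+ 2 * \sum_(j < N) cabs (dot (A (e k)) (e j)) ^+ 2)).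
      rewrite mulr_sumr; apply: ler_sum => j _; case: (leP (w k) (w j)) => kj.
        by rewrite rnorm0 expr0n/= mulr_ge0// sqr_ge0.
      rewrite -exprMn cabsM ler_sqr ?nnegrE ?mulr_ge0 ?rnorm_ge0//.
      apply: ler_wpM2r; first exact: rnorm_ge0.
      by have := Mw j k; rewrite max_r// ltW.
    by rewrite exprMn mulrC ler_wpM2r ?sqr_ge0//; exact: matrix_column_le.
  by exists c.
have [r Hr] := choice row_ex; have [c Hc] := choice col_ex.
exists (fun i => if odd i then e i./2 else r i./2).
exists (fun i => if odd i then c i./2 else e i./2).
split=> [i|j k N jN kN].
  case: ifP => _; rewrite rnorm_basis ?mul1r ?mulr1; first exact: (Hc _).2.
  exact: (Hr _).2.
rewrite (sum_double (fun i => dot (e k) (if odd i then e i./2 else r i./2) *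
  dot (if odd i then c i./2 else e i./2) (e j))).
under eq_bigr => i _ do rewrite /= odd_double/= uphalf_double doubleK !oe.
rewrite big_split/= (bigD1 (Ordinal jN))//= big1 => [|i ij]; last first.
  by move: ij; rewrite -val_eqE/= => /negbTE ->; rewrite mulr0.
rewrite [X in _ + X](bigD1 (Ordinal kN))//= big1 => [|i ik]; last first.
  by move: ik; rewrite -val_eqE/= eq_sym => /negbTE ->; rewrite mul0r.
rewrite !eqxx mulr1 mul1r !addr0 dotC (Hr j).1 (Hc k).1.
by case: ifP => _; rewrite ?conjCK ?rmorph0 ?addr0 ?add0r.
Qed.

(** For [N] beyond [j] and [k] the partial sum already has the entry [c], so the
    difference is bounded by arbitrarily small remainders. *)
Lemma nuclear_matrix {T : {linear H -> H}} {g h : nat -> H} {t : nat -> R} {S : R}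
    {j k : nat} {c : R[i]} :
  nonneg_series t S -> nuclear_sum dot T g h t S ->
  (forall N, (j < N)%N -> (k < N)%N ->
     \sum_(i < N.*2) dot (e k) (g i) * dot (h i) (e j) = c) ->
  dot (T (e k)) (e j) = c.
Proof.
move=> tS TS gh; apply/eqP; rewrite -subr_eq0; apply/eqP.
have [_ _ small] := tS.
apply: (@rnorm0_eq0 R (R[i]^o)); apply: le_anti; rewrite rnorm_ge0 andbT.
apply/ler_addgt0Pr => d d0; rewrite add0r; have [M HM] := small d d0.
pose N := maxn M (maxn j k).+1.
have jkN : ((maxn j k).+1 <= N)%N by exact: leq_maxr.
have jN : (j < N)%N by apply: leq_trans jkN; rewrite ltnS leq_maxl.
have kN : (k < N)%N by apply: leq_trans jkN; rewrite ltnS leq_maxr.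
have MN : (M <= N.*2)%N.
  by apply: leq_trans (leq_maxl M (maxn j k).+1) _; rewrite -/N -addnn leq_addr.
rewrite -(gh N jN kN).
have -> : \sum_(i < N.*2) dot (e k) (g i) * dot (h i) (e j) =
    dot (\sum_(i < N.*2) dot (e k) (g i) *: h i) (e j).
  by rewrite dot_suml; apply: eq_bigr => i _; rewrite dotZl.
rewrite -linearBl/=; apply: le_trans (cauchy_schwarz _ Hdot _ _) _.
rewrite rnorm_basis mulr1; apply: le_trans (TS _ _) _; rewrite rnorm_basis mulr1.
exact: le_trans (remainder_nonincreasing _ _ tS MN) HM.
Qed.

End OperatorNorm.

Lemma seq_norm_pinfty_le {R : realType} {u : R^nat} :
  (seq_norm +oo u <= 1)%E -> forall j, `|u j| <= 1.
Proof.
rewrite /seq_norm unlock.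
have -> : (0 < @counting nat R [set: nat])%E = true.
  by rewrite /counting asboolF ?ltry//; exact: infinite_nat.
move=> /ess_supP[B [mB B0 sub]] j; apply: contrapT => uj.
have Bj : B j by apply: sub => /=; rewrite lee_fin.
have : (@counting nat R [set j] <= @counting nat R B)%E.
  by apply: le_measure; rewrite ?inE// => _ ->.
rewrite [in leRHS]B0 /counting asboolT; last exact: finite_set1.
by rewrite fset_set1 finmap.cardfs1 lee_fin ler10.
Qed.

(** * Norms of Schur multipliers *)

Section SchurMultiplier.
Context {R : realType} {H : completeNormedModType R[i]}.
Variable dot : {dot H for (@Num.conj R[i])}.
Hypothesis Hdot : norm_of_dot dot.

Lemma sum_half_le {F : nat -> R} {W : R} : (forall j, 0 <= F j) ->
  (forall N, \sum_(j < N) F j <= W) -> forall N, \sum_(i < N) F i./2 <= 2 * W.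
Proof.
move=> F0 FW N; apply: (@le_trans _ _ (\sum_(i < N.*2) F i./2)).
  rewrite -!(big_mkord xpredT (fun i => F i./2)).
  have NN : (N <= N.*2)%N by rewrite -addnn leq_addr.
  by rewrite (big_cat_nat _ NN)//= lerDl sumr_ge0.
rewrite (sum_double (fun i => F i./2)).
under eq_bigr => j _ do rewrite /= uphalf_double doubleK -mulr2n -mulr_natl.
by rewrite -mulr_sumr ler_pM2l.
Qed.

(** The inclusion of [l^p] in [l^1] for [p <= 1]: each [w j] is at most the [l^p]
    quasi-norm of [w], which gives [w j <= w j ^ p * B ^ (1 - p)]. *)
Lemma sum_le_of_sum_powR {w : nat -> R} {p W : R} : 0 < p <= 1 ->
  (forall j, 0 <= w j) -> (forall N, \sum_(j < N) w j `^ p <= W) ->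
  forall N, \sum_(j < N) w j <= W * (W `^ p^-1) `^ (1 - p).
Proof.
move=> /andP[p0 p1] w0 wW N; set B := W `^ p^-1.
have wp_le j : w j `^ p <= W.
  by apply: le_trans (wW j.+1); rewrite big_ord_recr/= lerDr sumr_ge0// => *; exact: powR_ge0.
have W0 : 0 <= W by apply: le_trans (wp_le 0); exact: powR_ge0.
have wB j : w j <= B.
  have -> : w j = (w j `^ p) `^ p^-1 by rewrite -powRrM divff ?gt_eqF// powRr1.
  by apply: ge0_ler_powR; rewrite ?nnegrE ?powR_ge0// invr_ge0 ltW.
have w_le j : w j <= w j `^ p * B `^ (1 - p).
  have [w1|w1] := eqVneq (w j) 0; first by rewrite {1}w1 mulr_ge0 ?powR_ge0.
  have -> : w j = w j `^ p * w j `^ (1 - p) by rewrite -powRD ?w1 ?implybT// subrKC powRr1.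
  have w2 := w0 j.
  have -> : (w j `^ p * w j `^ (1 - p)) `^ p = w j `^ p.
    by rewrite -powRD ?w1 ?implybT// subrKC powRr1.
  apply: ler_wpM2l; first exact: powR_ge0.
  by apply: ge0_ler_powR; rewrite ?nnegrE ?powR_ge0 ?subr_ge0.
apply: le_trans (ler_sum _ (fun (j : 'I_N) _ => w_le j)) _.
by rewrite -mulr_suml; apply: ler_wpM2r; [exact: powR_ge0|exact: wW].
Qed.

Lemma nuclear_schatten_norm_le {T : {linear H -> H}} {g h : nat -> H}
    {t : nat -> R} {S p K : R} :
  0 < p <= 1 -> (forall i, rnorm (g i) * rnorm (h i) <= t i) ->
  nonneg_series t S -> nuclear_sum dot T g h t S ->
  (forall M, \sum_(i < M) t i `^ p <= K) ->
  (schatten_norm dot p T <= (K `^ p^-1)%:E)%E.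
Proof.
move=> p01 ght [t0 eps0 small] TS tK; have /andP[p0 _] := p01.
apply: seq_norm_le => // N; rewrite /singular_values.
(* An operator that has no sequence of singular values gets the null sequence. *)
case: xgetP => [s _ Hs|_]; last first.
  rewrite big1 => [|j _]; last by rewrite normr0 powR0// gt_eqF.
  by have := tK 0; rewrite big_ord0.
have [_ [_ s0 _ _]] := Hs.
under eq_bigr => j _ do rewrite ger0_norm//.
exact: (nuclear_singular_values_le dot Hdot p01 Hs ght eps0 TS small tK).
Qed.

Variable e : nat -> H.
Hypothesis He : orthonormal_basis dot e.

(** The sum of the rank-one operators has the required matrix, hence is the only
    bounded operator that has it; so the bound on singular values applies to every
    Schur product. *)
Lemma schur_rank_one_decomposition {M : nat -> nat -> R[i]} {w : nat -> R} {p W : R}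
    {A : {linear H -> H}} {C : R} : 0 < p <= 1 ->
  (forall j, 0 <= w j) -> (forall j k, cabs (M j k) <= Order.max (w j) (w k)) ->
  (forall N, \sum_(j < N) w j `^ p <= W) ->
  0 <= C -> (forall x, rnorm (A x) <= C * rnorm x) ->
  (exists T, is_schur_product dot e M A T /\ compact_op T) /\
  (forall T, is_schur_product dot e M A T ->
     (schatten_norm dot p T <= ((2 * (C `^ p * W)) `^ p^-1)%:E)%E).
Proof.
move=> p01 w0 Mw wW C0 AC; have /andP[p0 p1] := p01.
have [g [h [ght gh]]] := schur_rank_one_terms dot Hdot e He w0 Mw C0 AC.
pose t i := C * w i./2.
have t0 i : 0 <= t i by rewrite mulr_ge0.
have tsum N : \sum_(i < N) t i <= C * (2 * (W * (W `^ p^-1) `^ (1 - p))).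
  rewrite -mulr_sumr; apply: ler_wpM2l => //; apply: sum_half_le => //.
  exact: sum_le_of_sum_powR.
have [S _ tS] := nonneg_series_ex t0 tsum.
have [T0 T0S] := nuclear_operator dot Hdot ght tS.
have T0M j k : dot (T0 (e k)) (e j) = M j k * dot (A (e k)) (e j).
  by apply: (nuclear_matrix dot Hdot e He tS T0S) => N; exact: gh.
have T0b : bounded_op T0 by exact: (nuclear_bounded dot tS T0S).
have tp N : \sum_(i < N) t i `^ p <= 2 * (C `^ p * W).
  rewrite (eq_bigr (fun i : 'I_N => C `^ p * w i./2 `^ p)); last first.
    by move=> i _; rewrite powRM.
  apply: (sum_half_le (F := fun j => C `^ p * w j `^ p)) => [j|N'].
    by rewrite mulr_ge0 ?powR_ge0.
  by rewrite -mulr_sumr; apply: ler_wpM2l; [exact: powR_ge0|exact: wW].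
split.
  exists T0; split; first by split.
  exact: (nuclear_compact dot Hdot ght tS T0S).
move=> T [Tb TM].
apply: (nuclear_schatten_norm_le p01 ght tS _ tp) => N z.
have -> : T z = T0 z.
  by apply: (eq_bounded_op dot e He Tb T0b) => j k; rewrite TM T0M.
exact: T0S.
Qed.

(** The factor 2 inside the power counts the rows and the columns: each weight
    [w j] bounds one rank-one operator of either kind. *)
Lemma schur_norm_max_weight {M : nat -> nat -> R[i]} {w : nat -> R} {p W : R} :
  0 < p <= 1 ->
  (forall j, 0 <= w j) -> (forall j k, cabs (M j k) <= Order.max (w j) (w k)) ->
  (forall N, \sum_(j < N) w j `^ p <= W) ->
  schur_maps_to_schatten dot e M p /\
  (schur_norm dot e M p <= ((2 * W) `^ p^-1)%:E)%E.
Proof.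
move=> p01 w0 Mw wW; split=> [A|].
  move=> /op_norm_lt_pinfty[C [C0 _ AC]].
  have [[T [TA Tc]] TS] := schur_rank_one_decomposition p01 w0 Mw wW C0 AC.
  by exists T => //; split=> //; apply: le_lt_trans (TS T TA) (ltry _).
apply: ge_ereal_sup => _ [T [A [A1 TA]] <-].
have Ab : bounded_op A by apply: le_lt_trans A1 (ltry _).
have [C [C0 AE AC]] := op_norm_lt_pinfty Ab.
have C1 : C <= 1 by rewrite AE lee_fin in A1.
have AC1 x : rnorm (A x) <= 1 * rnorm x.
  by apply: le_trans (AC x) _; apply: ler_wpM2r => //; exact: rnorm_ge0.
have [_ /(_ T TA)] := schur_rank_one_decomposition p01 w0 Mw wW ler01 AC1.
by rewrite powR1 mul1r.
Qed.

End SchurMultiplier.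

Theorem theorem2p5 (R : realType) (H : completeNormedModType R[i])
    (dot : {dot H for (@Num.conj R[i])}) (Hdot : norm_of_dot dot)
    (e : nat -> H) (He : orthonormal_basis dot e)
    (p alpha : R) (Hp : 0 < p <= 1) (Halpha : 0 < alpha)
    (f : R -> R[i]) (Hf : C1_11 f) (Hf0 : f 0 = 0)
    (HL : (Lalpha alpha f < +oo)%E)
    (lambda : R^nat) (Hlambda : (seq_norm (alpha * p)%:E lambda < +oo)%E)
    (Hlambda1 : (seq_norm +oo lambda <= 1)%E) :
  schur_maps_to_schatten dot e (divided_difference f lambda) p /\
  (schur_norm dot e (divided_difference f lambda) p
     <= (2 `^ p^-1)%:E * Lalpha alpha f
        * poweR (seq_norm (alpha * p)%:E lambda) alpha)%E.
Proof.
have /andP[p0 p1] := Hp.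
have [L [L0 LE HL']] := Lalpha_lt_pinfty HL.
have [S [S0 SE HS]] := seq_norm_lt_pinfty (mulr_gt0 Halpha p0) Hlambda.
have lam1 := seq_norm_pinfty_le Hlambda1.
pose w j := L * `|lambda j| `^ alpha.
have w0 j : 0 <= w j by rewrite mulr_ge0// powR_ge0.
have Mw j k : cabs (divided_difference f lambda j k) <= Order.max (w j) (w k).
  apply: le_trans (divided_difference_le Hf Halpha L0 HL' lam1 j k) _.
  by rewrite le_max; case: (leP `|lambda j| `|lambda k|) => _; rewrite lexx ?orbT.
have wW N : \sum_(j < N) w j `^ p <= L `^ p * S.
  rewrite (eq_bigr (fun j : 'I_N => L `^ p * `|lambda j| `^ (alpha * p))).
    by rewrite -mulr_sumr; apply: ler_wpM2l; [exact: powR_ge0|exact: HS].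
  by move=> j _; rewrite powRM ?powR_ge0// powRrM.
have [maps le] := schur_norm_max_weight dot Hdot e He Hp w0 Mw wW; split=> //.
apply: le_trans le _; rewrite LE SE poweR_EFin -!EFinM lee_fin.
rewrite !powRM ?mulr_ge0 ?powR_ge0// -!powRrM.
rewrite divff ?gt_eqF// powRr1// mulrA.
have -> : (alpha * p)^-1 * alpha = p^-1 by field; rewrite !gt_eqF.
exact: lexx.
Qed.
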